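(* Let $F$ be an absolutely continuous df with pdf $f$ and let $k$ be a fixed positive integer. Let $$U_k(x)=k\left(\frac{1-F(x)}{-\ln F(x)}\right)-F(x)\sum_{l=1}^{k-1}(k-l)\frac{(-\ln F(x))^{l-1}}{l!}$$ for $x$ with $F(x)>0$, and $U_k(x)=0$ when $F(x)=0$; and let $H_k(x)=1-(1-F(x))^k$, $x\in\mathbb{R}$. Then the following hold. (a) $U_k$ is a df with $r(U_k)=r(F)$ and with pdf $u_k(x)=\frac{kf(x)}{(-\ln F(x))^2}\left(\frac{1}{F(x)}-\sum_{l=0}^{k}\frac{(-\ln F(x))^l}{l!}\right)$ for $x$ with $0<F(x)<1$ (and $0$ elsewhere). (b) $\lim_{x\uparrow r(F)}\frac{1-U_k(x)}{(1-F(x))^k}=\frac{1}{(k+1)!}$, so that $U_k$ is tail equivalent to $H_k$. (c) If $F\in\mathcal{D}_l(\Phi_\alpha)$ for some $\alpha>0$, then $r(U_k)=r(F)=\infty$ and $U_k\in\mathcal{D}_l(\Phi_{k\alpha})$, with $\lim_{n\to\infty}U_k^n(a_nx+b_n)=\Phi_{k\alpha}(x)$, $x\in\mathbb{R}$, for $a_n=F^-\left(1-((k+1)!/n)^{1/k}\right)$, $b_n=0$. (d) If $F\in\mathcal{D}_l(\Psi_\alpha)$ for some $\alpha>0$, then $r(U_k)=r(F)<\infty$ and $U_k\in\mathcal{D}_l(\Psi_{k\alpha})$, with $\lim_{n\to\infty}U_k^n(a_nx+b_n)=\Psi_{k\alpha}(x)$, $x\in\mathbb{R}$, for $a_n=r(F)-F^-\left(1-((k+1)!/n)^{1/k}\right)$,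 $b_n=r(F)$. (e) If $F\in\mathcal{D}_l(\Lambda)$ and $v$ is a positive function on $(-\infty,r(F))$ with $\lim_{t\uparrow r(F)}\frac{1-F(t+v(t)x)}{1-F(t)}=e^{-x}$ for all $x\ge 0$ (so that $\lim_{n\to\infty} F^n(v(\beta_n)x+\beta_n)=\Lambda(x)$ with $\beta_n=F^-(1-1/n)$), then $r(U_k)=r(F)$ and $U_k\in\mathcal{D}_l(\Lambda)$, with $\lim_{n\to\infty}U_k^n(a_nx+b_n)=\Lambda(x)$, $x\in\mathbb{R}$, for $b_n=U_k^-(1-1/n)$, $a_n=v(b_n)/k$.
   Context: df means distribution function on $\mathbb{R}$. For a df $F$: $r(F)=\sup\{x:F(x)<1\}$ and $F^-(y)=\inf\{x:F(x)\ge y\}$. $\Phi_\alpha(x)=\exp(-x^{-\alpha})$ for $x>0$ and $0$ for $x\le 0$; $\Psi_\alpha(x)=\exp(-|x|^{\alpha})$ for $x<0$ and $1$ for $x\ge 0$; $\Lambda(x)=\exp(-e^{-x})$. $F\in\mathcal{D}_l(G)$ means that there exist $a_n>0$, $b_n\in\mathbb{R}$ with $\lim_{n\to\infty}F^n(a_nx+b_n)=G(x)$ at all continuity points $x$ of $G$. Two dfs $A,B$ are tail equivalent if $r(A)=r(B)$ and $\lim_{x\uparrow r(A)}\frac{1-A(x)}{1-B(x)}$ exists in $(0,\infty)$. The expression $\frac{1-t}{-\ln t}$ is read as $1$ at $t=1$, and $0^0=1$. Formulas for norming constants are read for all $n$ large enough that they are defined and $a_n>0$. *)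

(* Defs.v *)
From mathcomp Require Import all_boot all_order all_algebra.
From mathcomp Require Import all_classical all_reals all_analysis.
Set Implicit Arguments.
Unset Strict Implicit.
Unset Printing Implicit Defensive.
Import Order.TTheory GRing.Theory Num.Theory.
Import numFieldNormedType.Exports.
Local Open Scope classical_set_scope.
Local Open Scope ring_scope.

Section distribution_functions.
Context {R : realType}.
Implicit Types (F G A B f : R -> R) (a b : nat -> R) (x y : R).

Definition is_df F : Prop :=
  [/\ {homo F : x y / x <= y}, right_continuous F,
      F x @[x --> -oo] --> (0 : R) & F x @[x --> +oo] --> (1 : R)].

(* F is absolutely continuous with (Borel) density f *)
Definition has_pdf F f : Prop :=
  [/\ measurable_fun [set: R] f, (forall x, 0 <= f x) &
      forall x, (F x)%:E = (\int[lebesgue_measure]_(t in `]-oo, x]) (f t)%:E)%E].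

Definition right_end F : \bar R := ereal_sup [set x%:E | x in [set x | F x < 1]].

(* The real infimum is the true one for 0 < y < 1, the only levels that matter
   for the limits below; elsewhere the library's default value may occur. *)
Definition qinv F y : R := inf [set x | y <= F x].

(* The filter "x tends to r from below".  The right endpoint of a df is never
   -oo, so the value in that case is irrelevant. *)
Definition below (r : \bar R) : set_system R :=
  match r with
  | r'%:E => r'^'-
  | +oo%E => pinfty_nbhs R
  | -oo%E => ninfty_nbhs R
  end.

Definition tail_equivalent A B : Prop :=
  [/\ is_df A, is_df B, right_end A = right_end B &
      exists2 c : R, 0 < c &
        (1 - A x) / (1 - B x) @[x --> below (right_end A)] --> c].

Definition in_Dl F G : Prop :=
  exists a b, (forall n, 0 < a n) /\
    forall x, {for x, continuous G} ->
      (F (a n * x + b n)) ^+ n @[n --> \oo] --> G x.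

(* (a, b) are norming constants, defined for large n, with convergence on R *)
Definition norming F G a b : Prop :=
  (\forall n \near \oo, 0 < a n) /\
  forall x, (F (a n * x + b n)) ^+ n @[n --> \oo] --> G x.

Definition Phi (alpha x : R) : R :=
  if 0 < x then expR (- (x `^ (- alpha))) else 0.

Definition Psi (alpha x : R) : R :=
  if x < 0 then expR (- (`|x| `^ alpha)) else 1.

Definition Lambda (x : R) : R := expR (- expR (- x)).

Definition log_ratio (t : R) : R := if t == 1 then 1 else (1 - t) / - ln t.

Definition U (k : nat) F x : R :=
  if 0 < F x then
    k%:R * log_ratio (F x)
    - F x * \sum_(1 <= l < k) (k - l)%:R * ((- ln (F x)) ^+ l.-1 / l`!%:R)
  else 0.

Definition u (k : nat) F f x : R :=
  if 0 < F x < 1 then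
    k%:R * f x / (- ln (F x)) ^+ 2
    * ((F x)^-1 - \sum_(0 <= l < k.+1) (- ln (F x)) ^+ l / l`!%:R)
  else 0.

Definition H (k : nat) F x : R := 1 - (1 - F x) ^+ k.

(* 1 - ((k+1)!/n)^{1/k} *)
Definition level (k n : nat) : R := 1 - ((k.+1)`!%:R / n%:R) `^ (k%:R^-1).

End distribution_functions.

(* Main.v *)
Require Import Defs.
From mathcomp Require Import all_boot all_order all_algebra.
From mathcomp Require Import all_classical all_reals all_analysis.
From mathcomp Require Import measurable_realfun.
From mathcomp Require Import ring lra.
(** Put [s = - ln (F x)] and let [pgamma k] be the antiderivative of
    [exp (- w) * \sum_(l < k) w ^ l / l!] vanishing at [0]. Then
    [U_k = pgamma k s / s], the mean over [0, s] of a decreasing function going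
    from [1] to [0]; this gives monotonicity, and two integrations give
      [F (1 - F)^k / (k+1)! <= 1 - U_k <= (1 - F)^k / (F^k (k+1)!)],
    hence the tail equivalence. The density formula is the chain rule for a
    monotone integrand composed with the continuous [F], obtained by telescoping
    over a partition into small increments of [F].

    Attraction is expressed through the tail quantile [V s = F^-(1 - 1/s)]:
    [F^n (a_n x + b_n) -> G x] yields [(V (n y) - b_n) / a_n -> q y] with
    [G (q y) = exp (- 1 / y)]. Comparing the indices [n] and [2 n] shows that
    [b_n] may be replaced by [0] (Frechet) or by the right endpoint (Weibull),
    up to [o(a_n)]; for Gumbel the given [v] is compared with [a_n] through the
    point [x = 1]. Conversely, quantile limits give back tail limits
    [s (1 - F z) -> c], which the displayed bounds transfer to [U_k]. *)

Set Implicit Arguments.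
Unset Strict Implicit.
Unset Printing Implicit Defensive.
Import Order.TTheory GRing.Theory Num.Theory.
Import numFieldNormedType.Exports.
Local Open Scope classical_set_scope.
Local Open Scope ring_scope.

(** * Truncated exponential series *)

Section truncated_exponential.
Context {R : realType}.
Implicit Types (s t x : R) (n k : nat).

(** Everything about [U k F] passes through one function of the level [t = F x], studied once on
    []0, 1]] and then composed with [F]. The formulas have a Poisson reading: if [N] is Poisson of
    mean [s], then [pgamma k s] is the mean of [min (N, k)] and its derivative is the probability of
    [N < k]. The constant [(k+1)!] arises because the probability of [N >= k] is of order
    [s ^ k / k!], which is integrated once more and divided by [s]. Two obstacles shape the rest. A
    density is given only by an integral identity, so [F] need not be differentiable everywhere, and
    the density formula degenerates at the levels 0 and 1, which are reached by limits. And
    attraction supplies norming constants known only to exist, at integer indices, while the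
    constants to be validated involve the real index [(n / (k+1)!) ^ (1 / k)]; hence quantile limits
    compare a real sequence [s] with an integer sequence [N]. *)

Lemma is_derive_ge0_le (f df : R -> R) (a b : R) : a <= b ->
  (forall x, a <= x <= b -> is_derive x 1 f (df x)) ->
  (forall x, a < x < b -> 0 <= df x) -> f a <= f b.
Proof.
move=> ab dfx df_ge0.
have [|||c cab fE] := @MVT_segment R f df a b => //.
- by move=> x /[!in_itv]/= /andP[ax xb]; apply: dfx; rewrite !ltW.
- apply: derivable_within_continuous => x; rewrite in_itv/= => xab.
  by case: (dfx x xab).
move: ab; rewrite le_eqVlt => /predU1P[->//|ab].
have [||c' c'ab f'E] := @MVT R f df a b ab.
- by move=> x /[!in_itv]/= /andP[ax xb]; apply: dfx; rewrite !ltW.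
- apply: derivable_within_continuous => x; rewrite in_itv/= => xab.
  by case: (dfx x xab).
by rewrite -subr_ge0 f'E mulr_ge0 ?subr_ge0 ?(ltW ab) ?df_ge0.
Qed.

Definition texp n x : R := \sum_(0 <= l < n) x ^+ l / l`!%:R.

Lemma texpS n x : texp n.+1 x = texp n x + x ^+ n / n`!%:R.
Proof. by rewrite /texp big_nat_recr. Qed.

Lemma texp_at0 n : texp n.+1 0 = 1 :> R.
Proof.
by elim: n => [|n IH]; rewrite texpS ?IH /texp ?big_geq// ?expr0 ?divr1 ?add0r//
  exprS !mul0r addr0.
Qed.

Lemma texp_ge0 n x : 0 <= x -> 0 <= texp n x.
Proof. by move=> x0; apply: sumr_ge0 => i _; rewrite divr_ge0// exprn_ge0. Qed.

Lemma cvg_texp x : texp n x @[n --> \oo] --> expR x.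
Proof. exact: is_cvg_series_exp_coeff. Qed.

Lemma texp_le m n x : 0 <= x -> (m <= n)%N -> texp m x <= texp n x.
Proof.
move=> x0 /subnKC <-; elim: (n - m)%N => [|i]; first by rewrite addn0.
by move=> /le_trans; apply; rewrite addnS texpS lerDl divr_ge0// exprn_ge0.
Qed.

Lemma texp_le_expR n x : 0 <= x -> texp n x <= expR x.
Proof.
move=> x0; apply: (cvgr_to_ge (@cvg_texp x)); near=> m.
by apply: texp_le => //; near: m; exact: nbhs_infty_ge.
Unshelve. all: by end_near. Qed.

Lemma is_derive_texp n x : is_derive x 1 (texp n.+1) (texp n x).
Proof.
elim: n => [|n IH].
  rewrite (_ : texp 1 = cst 1) ?[texp 0 x]big_geq//.
    exact: is_derive_cst.
  by apply/funext => y; rewrite texpS [texp 0 y]big_geq// expr0 divr1 add0r.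
have -> : texp n.+2 = texp n.+1 + (n.+1`!%:R^-1 \*: (id ^+ n.+1)).
  apply/funext => y; rewrite texpS [y ^+ _ / _]mulrC.
  by rewrite /GRing.add/= exprfctE.
have := is_deriveD IH (is_deriveZ n.+1`!%:R^-1 (is_deriveX n.+1 (is_derive_id x 1))).
move=> /is_derive_eq; apply.
rewrite texpS; congr (_ + _).
rewrite /GRing.scale/= mulr1 factS natrM invfM mulrACA mulVf ?pnatr_eq0//.
by rewrite mul1r mulrC.
Qed.

(** The monomial [x ^ l / l!] occurs [k - l] times in the sum of truncations and [l] times in
    [x * texp k x], hence [k] times in all. This collapses the quotient rule in the derivative of
    [pgamma k s / s]. *)
Lemma sum_texp k x :
  \sum_(0 <= j < k) texp j.+1 x + x * texp k x = k%:R * texp k.+1 x.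
Proof.
elim: k => [|k IH]; first by rewrite big_geq// /texp big_geq// mulr0 mul0r addr0.
rewrite big_nat_recr//= texpS mulrDr addrACA IH.
rewrite [texp k.+2 x]texpS -natr1 mulrDl mul1r mulrDr texpS.
suff -> : x * (x ^+ k / k`!%:R) = (k%:R + 1) * (x ^+ k.+1 / k.+1`!%:R) by ring.
rewrite natr1 factS natrM invfM exprS.
by rewrite [RHS]mulrC -[RHS]mulrA [_ / _ * _]mulrAC mulVf ?pnatr_eq0// mul1r mulrA.
Qed.

(* The remainder of the exponential series divided by [s ^+ 2] is a series
   with nonnegative powers of [s] only. *)
Lemma texp_remainder_le n s t : (1 < n)%N -> 0 < s -> s <= t ->
  (expR s - texp n s) / s ^+ 2 <= (expR t - texp n t) / t ^+ 2.
Proof.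
move=> n1 s0 st; have t0 := lt_le_trans s0 st.
rewrite ler_pdivrMr ?exprn_gt0// mulrAC ler_pdivlMr ?exprn_gt0//.
have step i : (texp (n + i) s - texp n s) * t ^+ 2 <=
              (texp (n + i) t - texp n t) * s ^+ 2.
  elim: i => [|i IH]; first by rewrite addn0 !subrr !mul0r.
  rewrite addnS !texpS ![_ + _ / _ - _]addrAC ![(_ + _ / _) * _]mulrDl lerD//.
  rewrite ![_ / _`!%:R * _]mulrAC ler_pM2r ?invr_gt0 ?ltr0n ?fact_gt0//.
  (* As [1 < n], a square splits off each monomial; [s <= t] is used on the remaining exponent. *)
  have -> : (n + i = (n + i - 2) + 2)%N by rewrite subnK// ltn_addr.
  rewrite !(exprD _ (n + i - 2) 2) -[leLHS]mulrA -[leRHS]mulrA [s ^+ 2 * t ^+ 2]mulrC.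
  rewrite ler_wpM2r//.
    by rewrite mulr_ge0// exprn_ge0// ltW.
  by rewrite lerXn2r// nnegrE ltW.
have cv x : texp (n + i) x @[i --> \oo] --> expR x.
  have := cvg_comp (addn^~ n) (texp^~ x) (cvg_addnr n) (@cvg_texp x).
  by under [X in X @ _]funext do rewrite /= addnC.
apply: (ler_cvg_to (a := \oo) (f := fun i => (texp (n + i) s - texp n s) * t ^+ 2)
    (g := fun i => (texp (n + i) t - texp n t) * s ^+ 2)).
- by apply: cvgMl; apply: cvgB => //; exact: cvg_cst.
- by apply: cvgMl; apply: cvgB => //; exact: cvg_cst.
- by apply: nearW.
Qed.

End truncated_exponential.

(** * The transform of the levels *)

Section level_transform.
Context {R : realType}.
Implicit Types (s t x : R) (k : nat).

(** A sum of gamma distribution functions of shapes [1] to [k]. This form, rather than an integral,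
    gives the bounds [0] and [k] termwise and matches the finite sum in [U]. *)
Definition pgamma k s : R := \sum_(0 <= j < k) (1 - expR (- s) * texp j.+1 s).

Lemma pgamma0 k : pgamma k 0 = 0.
Proof.
by rewrite /pgamma big1// => j _; rewrite oppr0 expR0 mul1r texp_at0 subrr.
Qed.

Lemma is_derive_pgamma k s : is_derive s 1 (pgamma k) (expR (- s) * texp k s).
Proof.
elim: k => [|k IH].
  have -> : pgamma 0 = cst 0 by apply/funext => y; rewrite /pgamma big_geq.
  by rewrite /texp big_geq// mulr0; exact: is_derive_cst.
have dE : is_derive s 1 (fun y => expR (- y)) (- expR (- s)).
  by apply: is_derive_eq; rewrite mulrN1.
have -> : pgamma k.+1 = pgamma k + (cst 1 - (fun y => expR (- y)) * texp k.+1).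
  by apply/funext => y; rewrite /pgamma big_nat_recr.
have := is_deriveD IH (is_deriveB (is_derive_cst (1 : R) s 1)
  (is_deriveM dE (is_derive_texp k s))).
by move=> /is_derive_eq; apply; rewrite texpS /GRing.scale/=; ring.
Qed.

Lemma pgamma_le k s : 0 <= s -> pgamma k s <= k%:R.
Proof.
move=> s0; rewrite /pgamma sumrB sumr_const_nat subn0 -mulr_natl mulr1 gerBl.
by apply: sumr_ge0 => i _; rewrite mulr_ge0 ?expR_ge0 ?texp_ge0.
Qed.

Lemma pgamma_ge0 k s : 0 <= s -> 0 <= pgamma k s.
Proof.
move=> s0; apply: sumr_ge0 => i _.
by rewrite subr_ge0 expRN ler_pdivrMl ?expR_gt0// mulr1 texp_le_expR.
Qed.

Lemma is_derive_monomial n s :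
  is_derive s 1 (fun y : R => y ^+ n.+1 / n.+1`!%:R) (s ^+ n / n`!%:R).
Proof.
have -> : (fun y : R => y ^+ n.+1 / n.+1`!%:R) = texp n.+2 - texp n.+1.
  by apply/funext => y; rewrite !fctE /= [texp n.+2 y]texpS addrAC subrr add0r.
have := is_deriveB (is_derive_texp n.+1 s) (is_derive_texp n s).
by move=> /is_derive_eq; apply; rewrite texpS addrAC subrr add0r.
Qed.

(** At order [n.+1] the difference of the two sides vanishes at 0 and has the nonnegative derivative
    [(1 - exp (- y)) * y ^ n / n!]; order 0 is an equality. *)
Lemma texp_remainder_le_monomial n s : 0 <= s ->
  1 - expR (- s) * texp n s <= s ^+ n / n`!%:R.
Proof.
case: n => [|n] s0; first by rewrite /texp big_geq// expr0 mulr0 subr0 divr1.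
rewrite -subr_ge0.
pose f y : R := y ^+ n.+1 / n.+1`!%:R - (1 - expR (- y) * texp n.+1 y).
have f0 : f 0 = 0.
  by rewrite /f expr0n mul0r sub0r oppr0 expR0 mul1r texp_at0 subrr oppr0.
rewrite -f0; apply: (@is_derive_ge0_le _ f
  (fun y => (1 - expR (- y)) * (y ^+ n / n`!%:R))) => //.
  move=> y _.
  have dM := is_derive_monomial n y; have dT := is_derive_texp n y.
  have dE : is_derive y 1 (fun y => expR (- y)) (- expR (- y)).
    by apply: is_derive_eq; rewrite mulrN1.
  have -> : f = (fun y : R => y ^+ n.+1 / n.+1`!%:R) -
      (cst 1 - (fun y => expR (- y)) * texp n.+1) by [].
  apply: is_derive_eq.
  by rewrite texpS /GRing.scale/=; ring.
move=> y /andP[y0 _]; rewrite mulr_ge0//.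
  by rewrite subr_ge0 expR_le1 oppr_le0 ltW.
by rewrite divr_ge0// exprn_ge0// ltW.
Qed.

(** The previous bound integrated from 0, since [s - pgamma k s] has derivative
    [1 - exp (- s) * texp k s]. *)
Lemma pgamma_defect_le k s : 0 <= s -> s - pgamma k s <= s ^+ k.+1 / k.+1`!%:R.
Proof.
move=> s0; rewrite -subr_ge0.
pose f y : R := y ^+ k.+1 / k.+1`!%:R - (y - pgamma k y).
have f0 : f 0 = 0 by rewrite /f expr0n mul0r pgamma0 !subr0.
rewrite -f0; apply: (@is_derive_ge0_le _ f
  (fun y => (y ^+ k / k`!%:R) - (1 - expR (- y) * texp k y))) => //.
  move=> y _; have dM := is_derive_monomial k y; have dG := is_derive_pgamma k y.
  exact: is_deriveB.
by move=> y /andP[/ltW y0 _]; rewrite subr_ge0 texp_remainder_le_monomial.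
Qed.

(** Thanks to the factor [exp (- s)], the derivative of the difference regroups into the remainder
    of order [k.+1] plus a positive monomial term, both nonnegative. *)
Lemma pgamma_defect_ge k s : 0 <= s ->
  expR (- s) * (s ^+ k.+1 / k.+1`!%:R) <= s - pgamma k s.
Proof.
move=> s0; rewrite -subr_ge0.
pose f y : R := (y - pgamma k y) - expR (- y) * (y ^+ k.+1 / k.+1`!%:R).
have f0 : f 0 = 0 by rewrite /f expr0n mul0r pgamma0 mulr0 !subr0.
rewrite -f0; apply: (@is_derive_ge0_le _ f (fun y => (1 - expR (- y) * texp k.+1 y)
    + expR (- y) * (y ^+ k.+1 / k.+1`!%:R))) => //.
  move=> y _; have dM := is_derive_monomial k y; have dG := is_derive_pgamma k y.
  have dE : is_derive y 1 (fun y => expR (- y)) (- expR (- y)).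
    by apply: is_derive_eq; rewrite mulrN1.
  have -> : f = (id - pgamma k) -
     (fun y => expR (- y)) * (fun y : R => y ^+ k.+1 / k.+1`!%:R) by [].
  apply: is_derive_eq.
  by rewrite texpS /GRing.scale/=; ring.
move=> y /andP[/ltW y0 _]; rewrite addr_ge0//.
  by rewrite subr_ge0 expRN ler_pdivrMl ?expR_gt0// mulr1 texp_le_expR.
by rewrite mulr_ge0 ?expR_ge0// divr_ge0// exprn_ge0.
Qed.

(* [U k F] is [level_transform k] composed with [F]. *)
Definition level_transform k t : R :=
  if 0 < t then
    k%:R * log_ratio t
    - t * \sum_(1 <= l < k) (k - l)%:R * ((- ln t) ^+ l.-1 / l`!%:R)
  else 0.

Lemma sum_texp_weighted k s :
  \sum_(0 <= j < k) texp j.+1 s = \sum_(0 <= l < k) (k - l)%:R * (s ^+ l / l`!%:R).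
Proof.
elim: k => [|k IH]; first by rewrite !big_geq.
rewrite big_nat_recr//= IH texpS addrA /texp -big_split/=.
rewrite [RHS]big_nat_recr//= subSnn mul1r; congr (_ + _).
rewrite !big_nat; apply: eq_bigr => l /andP[_ lk].
by rewrite subSn ?(ltnW lk)// -natr1 mulrDl mul1r.
Qed.

(** In the weighted sum the term [l = 0] equals [k] and combines into [k * (1 - t)], the numerator
    of the logarithmic ratio; every other term carries a factor [s = - ln t] that the division
    removes. *)
Lemma level_transformE k t : 0 < t < 1 ->
  level_transform k t = pgamma k (- ln t) / (- ln t).
Proof.
move=> /[dup] /andP[t0 t1] /ln_lt0 lt0.
rewrite /level_transform t0 /log_ratio lt_eqF// /pgamma.
have -> : expR (- - ln t) = t by rewrite opprK lnK.
rewrite sumrB sumr_const_nat subn0 -mulr_natl mulr1 -mulr_sumr.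
have s0 : - ln t != 0 by rewrite oppr_eq0 lt_eqF.
rewrite sum_texp_weighted; case: k => [|k]; first by rewrite !big_geq// !mulr0 mul0r !subrr mul0r.
rewrite [in RHS]big_ltn// expr0 divr1 mulr1 subn0.
have -> : \sum_(1 <= l < k.+1) (k.+1 - l)%:R * ((- ln t) ^+ l / l`!%:R) =
   (- ln t) * \sum_(1 <= l < k.+1) (k.+1 - l)%:R * ((- ln t) ^+ l.-1 / l`!%:R).
  rewrite mulr_sumr !big_nat; apply: eq_bigr => -[|l]//= _.
  by rewrite exprS -mulrA mulrCA.
by field; rewrite lt_eqF.
Qed.

Lemma level_transform1 k : (0 < k)%N -> level_transform k 1 = 1.
Proof.
move=> k0; rewrite /level_transform ltr01 /log_ratio eqxx ln1 oppr0 mulr1 mul1r.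
case: k k0 => [//|[|k]] _; first by rewrite big_geq// subr0.
(* Only [l = 1] survives, with [0 ^ 0 = 1], and leaves [k - (k - 1)]. *)
rewrite big_ltn// big_nat big1 => [|[|[|l]]//= _]; last by rewrite exprS !mul0r mulr0.
by rewrite addr0 expr0 divr1 mulr1 subn1/= -natr1 addrAC subrr add0r.
Qed.

(** With [s = - ln t] the defect is [(s - pgamma k s) / s], which lies between [t * s ^ k / (k+1)!]
    and [s ^ k / (k+1)!]; then [1 - t <= s <= (1 - t) / t] eliminates [s]. *)
Lemma level_transform_bounds k t : (0 < k)%N -> 0 < t <= 1 ->
  t * (1 - t) ^+ k / k.+1`!%:R <= 1 - level_transform k t <=
  (1 - t) ^+ k / t ^+ k / k.+1`!%:R.
Proof.
move=> k0 /andP[t0]; rewrite le_eqVlt => /predU1P[->|t1].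
  by rewrite level_transform1// subrr expr0n gtn_eqF//= !mulr0 !mul0r lexx.
have ln0 : ln t < 0 by rewrite ln_lt0 ?t0.
set s := - ln t; have s0 : 0 < s by rewrite oppr_gt0.
have tE : t = expR (- s) by rewrite opprK lnK.
have s1 : 1 - t <= s by rewrite lerNr opprB -[t in ln t](subrK 1) addrC le_ln1Dx//; lra.
have s2 : s <= (1 - t) / t.
  rewrite /s -lnV ?posrE// mulrBl mul1r divff ?gt_eqF//.
  have := @le_ln1Dx R (t^-1 - 1); rewrite [1 + _]addrC subrK; apply.
  by rewrite ltrBrDl subrr invr_gt0.
have defectE : 1 - level_transform k t = (s - pgamma k s) / s.
  by rewrite level_transformE ?t0// -/s mulrBl divff ?gt_eqF.
apply/andP; split; rewrite defectE.
  rewrite ler_pdivlMr//. apply: le_trans (pgamma_defect_ge _ (ltW s0)).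
  rewrite -tE exprS -!mulrA ler_pM2l// [leRHS]mulrC mulrA ler_pM2r//.
  by rewrite ler_wpM2r// lerXn2r// nnegrE ?subr_ge0 ltW.
rewrite ler_pdivrMr//; apply: (le_trans (pgamma_defect_le k (ltW s0))).
rewrite exprS -mulrA [leLHS]mulrC ler_pM2r// ler_wpM2r//.
by rewrite -expr_div_n lerXn2r// nnegrE ?ltW// divr_gt0// subr_gt0.
Qed.

End level_transform.

(** * Derivative, monotonicity and continuity of the level transform *)

Section level_transform_variation.
Context {R : realType}.
Implicit Types (s t x : R) (k : nat).

(** With [s = - ln t] one has [t^-1 = exp s], so the bracket is a remainder of the exponential
    series. The value 0 outside []0, 1[] is a convention. *)
Definition level_density k t : R :=
  if 0 < t < 1 then
    k%:R / (- ln t) ^+ 2 * (t^-1 - texp k.+1 (- ln t))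
  else 0.

Lemma level_density_ge0 k t : 0 <= level_density k t.
Proof.
rewrite /level_density; case: ifPn => // /[dup] /andP[t0 t1] /ln_lt0 lt0.
rewrite mulr_ge0 ?divr_ge0 ?sqr_ge0// subr_ge0.
by rewrite -[t^-1]lnK ?posrE ?invr_gt0// lnV ?posrE// texp_le_expR// oppr_ge0 ltW.
Qed.

(** In the variable [s = - ln t] this is [k] times the series remainder over [s ^ 2], which grows
    with [s]; the order [k.+1] is at least 2 because [k] is positive. The convention 0 from level 1
    on preserves monotonicity. *)
Lemma level_density_nincr k t t' : (0 < k)%N -> 0 < t -> t <= t' ->
  level_density k t' <= level_density k t.
Proof.
move=> k0 t0 tt'; have [t'1|t'1] := ltP t' 1; last first.
  by rewrite {1}/level_density [t' < 1]ltNge t'1 andbF level_density_ge0.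
have t'0 := lt_le_trans t0 tt'; have t1 := le_lt_trans tt' t'1.
rewrite /level_density t0 t1 t'0 t'1/= -!mulrA ler_wpM2l//.
rewrite [leLHS]mulrC [leRHS]mulrC.
have e x : 0 < x -> x^-1 = expR (- ln x).
  by move=> x0; rewrite -lnV ?posrE// lnK// posrE invr_gt0.
rewrite (e _ t0) (e _ t'0) texp_remainder_le// ?oppr_gt0 ?ln_lt0 ?t'0//.
by rewrite lerN2 ler_ln ?posrE.
Qed.

Lemma is_derive_level_transform k t : 0 < t < 1 ->
  is_derive t 1 (level_transform k) (level_density k t).
Proof.
move=> t01; have /andP[t0 t1] := t01; have lt0 := ln_lt0 t01.
have s0 : - ln t != 0 by rewrite oppr_eq0 lt_eqF.
pose f := (pgamma k * (fun s : R => s^-1)) \o (fun x : R => - ln x).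
have : is_derive t 1 f (level_density k t).
  have dG := is_derive_pgamma k (- ln t).
  have dV : is_derive (- ln t) 1 (fun s : R => s^-1) (- (- ln t) ^- 2 *: 1).
    exact: (@is_deriveV R id).
  have dL : is_derive t 1 (fun x : R => - ln x) (- t^-1).
    by have := is_derive1_ln t0 => dL; exact: is_deriveN.
  apply: is_derive_eq.
  have tE : expR (- - ln t) = t by rewrite opprK lnK.
  rewrite /level_density t01 /GRing.scale/= tE mulr1.
  have := sum_texp k (- ln t).
  rewrite /pgamma tE.
  rewrite sumrB sumr_const_nat subn0 -mulr_natl mulr1 -mulr_sumr.
  move=> /(canRL (addrK _)) ->.
  by field; rewrite gt_eqF// lt_eqF.
apply: near_eq_is_derive.
near=> x; rewrite /f/= level_transformE//.
near: x; apply: near_in_itvoo.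
by rewrite in_itv.
Unshelve. all: by end_near. Qed.

Lemma cvgr_exprn {T} {G : set_system T} {FF : Filter G} n (f : T -> R) (a : R) :
  f @ G --> a -> f i ^+ n @[i --> G] --> a ^+ n.
Proof.
by move=> fa; apply: (cvg_comp f (fun y => y ^+ n) fa); exact: exprn_continuous.
Qed.

(** Continuity at level 1 is obtained from the left only: the two bounds, valid for [t <= 1],
    squeeze the defect to 0. *)
Lemma level_transform_cvg1 {T : topologicalType} {G : set_system T} {FF : Filter G} k (f : T -> R) :
  (0 < k)%N -> f @ G --> (1 : R) -> (\forall i \near G, f i <= 1) ->
  level_transform k (f i) @[i --> G] --> (1 : R).
Proof.
move=> k0 f1 fle1.
pose g i := (1 - f i) ^+ k / (f i) ^+ k / k.+1`!%:R.
have g0 : g @ G --> (0 : R).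
  have -> : (0 : R) = (1 - 1) ^+ k / (1 ^+ k) / k.+1`!%:R.
    by rewrite subrr expr0n gtn_eqF// !mul0r.
  apply: cvgMl; apply: cvgM.
    by apply: cvgr_exprn; apply: cvgB => //; exact: cvg_cst.
  by apply: cvgV; [rewrite expr1n oner_neq0|exact: cvgr_exprn].
apply: (@squeeze_cvgr _ _ _ _ (fun i => 1 - g i) (cst 1)).
- near=> x.
  have fx0 : 0 < f x by near: x; exact: (cvgr_gt _ f1 _ ltr01).
  have fx1 : f x <= 1 by near: x.
  have fx01 : 0 < f x <= 1 by rewrite fx0.
  have /andP[A B] := level_transform_bounds k0 fx01.
  rewrite lerBlDr -lerBlDl B/= -subr_ge0; apply: le_trans A.
  by rewrite divr_ge0// mulr_ge0 ?(ltW fx0)// exprn_ge0// subr_ge0.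
- by have := cvgB (cvg_cst (1 : R)) g0; rewrite subr0; apply.
- exact: cvg_cst.
Unshelve. all: by end_near. Qed.

(** Mean value theorem with a nonincreasing derivative. At [t' = 1], outside the range of the
    derivative formula, the upper bound is a left limit and the lower one only says that the
    increment is nonnegative, as [level_density k 1 = 0]. *)
Lemma level_transform_increment k t t' : (0 < k)%N -> 0 < t -> t <= t' -> t' <= 1 ->
  level_density k t' * (t' - t) <= level_transform k t' - level_transform k t
  <= level_density k t * (t' - t).
Proof.
move=> k0 t0 tt' t'1.
have main x : t <= x -> x < 1 ->
  level_density k x * (x - t) <= level_transform k x - level_transform k t
  <= level_density k t * (x - t).
  move=> tx x1; have [||c] := @MVT_segment R (level_transform k) (level_density k) t x tx.
  - move=> y /[!in_itv]/= /andP[ty yx]; apply: is_derive_level_transform.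
    by rewrite (lt_trans t0)//= (lt_trans yx).
  - apply: derivable_within_continuous => y; rewrite in_itv/= => /andP[ty yx].
    have [] // := @is_derive_level_transform k y.
    by rewrite (lt_le_trans t0)//= (le_lt_trans yx).
  rewrite in_itv/= => /andP[tc cx] ->.
  by rewrite !ler_wpM2r ?subr_ge0// level_density_nincr// (lt_le_trans t0).
have [/main->//|] := ltP t' 1.
move=> /(conj t'1)/andP; rewrite -eq_le => /eqP ->.
have t1 : t <= 1 by apply: le_trans tt' t'1.
rewrite level_transform1// {1}/level_density ltxx andbF mul0r.
move: t1; rewrite le_eqVlt => /predU1P[->|t1].
  by rewrite level_transform1// subrr mulr0 lexx.
apply/andP; split.
  have t01 : 0 < t <= 1 by rewrite t0 ltW.
  have /andP[h _] := level_transform_bounds k0 t01.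
  by apply: le_trans h; rewrite divr_ge0// mulr_ge0 ?(ltW t0)// exprn_ge0// subr_ge0 ltW.
apply: (ler_cvg_to (a := (1 : R)^'-)
  (f := fun x => level_transform k x - level_transform k t)
  (g := fun x => level_density k t * (x - t))).
- apply: cvgB; last exact: cvg_cst.
  apply: level_transform_cvg1 => //; first exact: cvg_at_left_filter.
  by near=> x; apply: ltW; near: x; exact: nbhs_left_lt.
- apply: cvgMr; apply: cvgB; last exact: cvg_cst.
  exact: cvg_at_left_filter.
- near=> x.
  have tx : t <= x by apply: ltW; near: x; exact: nbhs_left_gt.
  have x1 : x < 1 by near: x; exact: nbhs_left_lt.
  by have /andP[] := main x tx x1.
Unshelve. all: by end_near. Qed.

Lemma level_transform_ndecr k t t' : (0 < k)%N -> 0 <= t -> t <= t' -> t' <= 1 ->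
  level_transform k t <= level_transform k t'.
Proof.
move=> k0; rewrite le_eqVlt => /predU1P[<-{t} t'0|t0] tt'.
  move: t'0; rewrite le_eqVlt => /predU1P[<-//|t'0].
  rewrite {1}/level_transform ltxx.
  move: tt'; rewrite le_eqVlt => /predU1P[->|t'1]; first by rewrite level_transform1.
  rewrite level_transformE ?t'0//.
  have s0 : 0 <= - ln t' by rewrite oppr_ge0 ln_le0// ltW.
  by rewrite divr_ge0// pgamma_ge0.
move=> t'1; have /andP[h _] := level_transform_increment k0 t0 tt' t'1.
rewrite -subr_ge0; apply: le_trans h.
by rewrite mulr_ge0 ?level_density_ge0 ?subr_ge0.
Qed.

Lemma level_transform_le0 k t : t <= 0 -> level_transform k t = 0.
Proof. by rewrite /level_transform leNgt => /negbTE ->. Qed.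

Lemma continuous_level_transform k t : (0 < k)%N -> 0 <= t < 1 ->
  {for t, continuous (level_transform k)}.
Proof.
move=> k0 /andP[]; rewrite le_eqVlt => /predU1P[<- _|t0 t1]; last first.
  apply/differentiable_continuous/derivable1_diffP.
  by have [] := @is_derive_level_transform k t; rewrite ?t0.
apply/cvgrPdist_le => e e0; rewrite [level_transform k 0]level_transform_le0//.
near=> x; rewrite sub0r normrN.
have [x0|x0] := leP x 0; first by rewrite level_transform_le0 ?normr0// ltW.
have x1 : x < 1 by near: x; exact: lt_nbhsl.
have s0 : 0 < - ln x by rewrite oppr_gt0 ln_lt0// x0.
rewrite level_transformE ?x0// ger0_norm ?divr_ge0 ?pgamma_ge0 ?(ltW s0)//.
rewrite ler_pdivrMr//; apply: le_trans (pgamma_le _ (ltW s0)) _.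
(* The transform is at most [k / (- ln x)], hence at most [e] once [x < exp (- k / e)]. *)
rewrite mulrC -ler_pdivrMr// lerNr -[leRHS]expRK ler_ln ?posrE ?expR_gt0//.
by apply: ltW; near: x; apply: lt_nbhsl; rewrite expR_gt0.
Unshelve. all: by end_near. Qed.

Lemma level_transform_lt1 k t : (0 < k)%N -> 0 <= t <= 1 ->
  (level_transform k t < 1) = (t < 1).
Proof.
move=> k0 /andP[]; rewrite le_eqVlt => /predU1P[<-{t} _|t0].
  by rewrite level_transform_le0 ?ltr01.
rewrite le_eqVlt => /predU1P[->|t1]; first by rewrite level_transform1// !ltxx.
have t01 : 0 < t <= 1 by rewrite t0 ltW.
have /andP[h _] := level_transform_bounds k0 t01.
rewrite t1 -subr_gt0; apply: lt_le_trans h.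
by rewrite divr_gt0 ?ltr0n ?fact_gt0// mulr_gt0// exprn_gt0// subr_gt0.
Qed.

End level_transform_variation.

(** * Densities *)

Section distribution_function.
Context {R : realType}.
Implicit Types (F f : R -> R) (a b x y : R).

Lemma df_ge0 F x : is_df F -> 0 <= F x.
Proof.
move=> [F_homo _ F0 _]; apply: (cvgr_to_le F0).
by near=> y; apply: F_homo; near: y; apply: nbhs_ninfty_le; exact: num_real.
Unshelve. all: by end_near. Qed.

Lemma df_le1 F x : is_df F -> F x <= 1.
Proof.
move=> [F_homo _ _ F1]; apply: (cvgr_to_ge F1).
by near=> y; apply: F_homo; near: y; apply: nbhs_pinfty_ge; exact: num_real.
Unshelve. all: by end_near. Qed.

Lemma df_lt_inv F x y : is_df F -> F x < F y -> x < y.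
Proof. by move=> [F_homo _ _ _]; rewrite !ltNge; apply: contra; exact: F_homo. Qed.

Lemma df_IVT F y : is_df F -> continuous F -> 0 < y < 1 -> exists x, F x = y.
Proof.
move=> [F_homo _ F0 F1] cF /andP[y0 y1].
have [a Fay] : exists a, F a < y.
  exact: (@filter_ex _ _ _ _ (cvgr_lt _ F0 _ y0)).
have [b yFb] : exists b, y < F b.
  exact: (@filter_ex _ _ _ _ (cvgr_gt _ F1 _ y1)).
have ab : a <= b by rewrite leNgt; apply/negP => /ltW /F_homo; lra.
have [||x _ <-] := @IVT R F a b y ab; last by exists x.
  exact: continuous_subspaceT.
by rewrite ge_min le_max (ltW Fay) (ltW yFb) orbT.
Qed.

Variables (F f : R -> R).
Hypotheses (F_df : is_df F) (F_pdf : has_pdf F f).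
Let mu := @lebesgue_measure R.

Lemma pdf_integral_oc a b : a <= b ->
  (\int[mu]_(t in `]a, b]) (f t)%:E = (F b - F a)%:E)%E.
Proof.
move=> ab; have [mf f0 FE] := F_pdf.
have := FE b.
rewrite (@itv_bndbnd_setU _ _ _ (BRight a)); last 2 first.
  by [].
  by rewrite bnd_simp.
rewrite ge0_integral_setU//=; last 3 first.
- by apply/measurable_EFinP; exact: measurable_funTS.
- by move=> x _; rewrite lee_fin.
- by apply: lt_disjoint => x y; rewrite !in_itv/= => xa /andP[ay _]; exact: le_lt_trans ay.
by rewrite -FE EFinB => ->; rewrite addeAC subee// add0e.
Qed.

(** The primitive of an integrable function on a segment is continuous; on the window
    [[x - 1, x + 1]] the integral of [f] is finite, being an increment of [F]. *)
Lemma pdf_df_continuous : continuous F.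
Proof.
move=> x; have [mf f0 FE] := F_pdf.
have ab : x - 1 < x + 1 by lra.
have intf : mu.-integrable `[(x - 1), (x + 1)] (EFin \o f).
  apply/integrableP; split.
    by apply/measurable_EFinP; exact: measurable_funTS.
  under eq_integral do rewrite gee0_abs ?lee_fin//.
  rewrite -integral_itv_obnd_cbnd//.
    by rewrite pdf_integral_oc ?ltry// ltW.
  by apply/measurable_EFinP; exact: measurable_funTS.
have xab : x \in `]x - 1, x + 1[ by rewrite in_itv/=; apply/andP; split; lra.
have cx := within_continuous_continuous ab
  (parameterized_integral_continuous (ltW ab) intf) xab.
have FE' : \forall y \near x, F (x - 1) + parameterized_integral mu (x - 1) y f = F y.
  near=> y; rewrite /parameterized_integral /Rintegral.
  have xy : x - 1 < y by near: y; apply: lt_nbhsr; lra.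
  rewrite -integral_itv_obnd_cbnd//; last first.
    by apply/measurable_EFinP; exact: measurable_funTS.
  by rewrite pdf_integral_oc ?(ltW xy)//= [LHS]addrC subrK.
rewrite /continuous_at -(nbhs_singleton FE').
by apply: cvg_trans (cvgD (cvg_cst (F (x - 1))) cx); exact: near_eq_cvg.
Unshelve. all: by end_near. Qed.

End distribution_function.

(** * Integral of the transformed density *)

Section density_of_the_transform.
Context {R : realType}.
Variables (k : nat) (F f : R -> R).
Hypotheses (k_gt0 : (0 < k)%N) (F_df : is_df F) (F_pdf : has_pdf F f).
Let mu := @lebesgue_measure R.
Let g := @level_transform R k.
Let h := @level_density R k.
Let w t := h (F t) * f t.

Lemma measurable_level_density_df : measurable_fun setT (fun t => h (F t)).
Proof.
have [F_homo _ _ _] := F_df.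
have mF : measurable_fun setT F by exact: nondecreasing_measurable.
have ml : measurable_fun setT (fun t => - ln (F t)).
  by apply: measurable_funN; apply: measurableT_comp => //; exact: measurable_ln.
have mtexp : measurable_fun setT (@texp R k.+1).
  apply: continuous_measurable_fun => x.
  apply/differentiable_continuous/derivable1_diffP.
  by have [] := is_derive_texp k x.
have -> : (fun t => h (F t)) = fun t => if (0 < F t) && (F t < 1) then
   k%:R * (- ln (F t)) `^ (- 2%:R) * (F t `^ (-1) - texp k.+1 (- ln (F t))) else 0.
  apply/funext => t; rewrite /h /level_density; case: ifPn => // /andP[Ft0 Ft1].
  rewrite powR_inv1 ?(ltW Ft0)// powR_invn ?oppr_ge0 ?ln_le0 ?(ltW Ft1)//.
apply: measurable_fun_ifT => //.
  by apply: measurable_and; apply: measurable_fun_ltr.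
apply: measurable_funM.
  apply: measurable_funM => //.
  exact: (measurableT_comp (measurable_powR (- 2%:R)) ml).
apply: measurable_funB; last exact: (measurableT_comp mtexp ml).
exact: (measurableT_comp (measurable_powR (- 1)) mF).
Qed.

Lemma transformed_density_ge0 t : 0 <= w t.
Proof. by have [_ f0 _] := F_pdf; rewrite mulr_ge0 ?level_density_ge0. Qed.

Lemma measurable_transformed_density D : measurable_fun D (fun t => (w t)%:E).
Proof.
apply/measurable_EFinP; apply: (@measurable_funS _ _ _ _ setT) => //.
by have [mf _ _] := F_pdf; apply: measurable_funM => //; exact: measurable_level_density_df.
Qed.

(** On []a, b]] the factor [h (F t)] lies between [h (F b)] and [h (F a)], and [f] integrates to
    [F b - F a]. Positivity of [F a] excludes level 0, where the conventional value of [h] breaks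
    its monotonicity. *)
Lemma integral_transformed_density_bounds a b : 0 < F a -> a <= b ->
  ((h (F b) * (F b - F a))%:E <= \int[mu]_(t in `]a, b]) (w t)%:E
   <= (h (F a) * (F b - F a))%:E)%E.
Proof.
move=> Fa0 ab; have [F_homo _ _ _] := F_df; have [mf f0 _] := F_pdf.
have mfE D : measurable_fun D (fun t => (f t)%:E).
  by apply/measurable_EFinP; exact: measurable_funTS.
have mfEZ c D : measurable_fun D (fun t => (c%:E * (f t)%:E)%E).
  by apply/measurable_EFinP; apply: measurable_funM => //; exact: measurable_funTS.
rewrite !EFinM -(pdf_integral_oc F_pdf ab).
rewrite -!ge0_integralZl ?lee_fin ?level_density_ge0//; last 4 first.
  exact: mfE.
  by move=> x _; rewrite lee_fin.
  exact: mfE.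
  by move=> x _; rewrite lee_fin.
apply/andP; split; apply: ge0_le_integral => //.
- by move=> x _; rewrite -EFinM lee_fin mulr_ge0// level_density_ge0.
- exact: mfEZ.
- exact: measurable_transformed_density.
- move=> x /=; rewrite in_itv/= => /andP[ax xb].
  rewrite -EFinM lee_fin ler_wpM2r//; apply: level_density_nincr => //.
    by apply: lt_le_trans Fa0 _; apply: F_homo; exact: ltW.
  exact: F_homo.
- by move=> x _; rewrite lee_fin transformed_density_ge0.
- exact: measurable_transformed_density.
- exact: mfEZ.
- move=> x /=; rewrite in_itv/= => /andP[ax xb].
  rewrite -EFinM lee_fin ler_wpM2r//; apply: level_density_nincr => //.
  by apply: F_homo; exact: ltW.
Qed.

Lemma integral_transformed_density_split a y b : a <= y -> y <= b ->
  (\int[mu]_(t in `]a, b]) (w t)%:E =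
   \int[mu]_(t in `]a, y]) (w t)%:E + \int[mu]_(t in `]y, b]) (w t)%:E)%E.
Proof.
move=> ay yb; rewrite (@itv_bndbnd_setU _ _ _ (BRight y)); last 2 first.
  by rewrite bnd_simp.
  by rewrite bnd_simp.
rewrite ge0_integral_setU//=.
- exact: measurable_transformed_density.
- by move=> x _; rewrite lee_fin transformed_density_ge0.
- apply: lt_disjoint => u v; rewrite !in_itv/= => /andP[_ ua] /andP[av _].
  exact: le_lt_trans av.
Qed.

(* On a piece where [F] increases by [d], the integral and the increment of
   [g] lie between the same bounds, so the errors telescope. *)
Lemma integral_transformed_density_telescope a d i x : 0 < F a -> 0 <= d -> a <= x ->
  F x = F a + i%:R * d ->
  exists2 I, (\int[mu]_(t in `]a, x]) (w t)%:E = I%:E)%E &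
    `|I - (g (F x) - g (F a))| <= (h (F a) - h (F x)) * d.
Proof.
move=> Fa0 d0; have [F_homo _ _ _] := F_df.
have step y z : 0 < F y -> y <= z -> F z - F y <= d ->
  exists2 I, (\int[mu]_(t in `]y, z]) (w t)%:E = I%:E)%E &
    `|I - (g (F z) - g (F y))| <= (h (F y) - h (F z)) * d.
  move=> Fy0 yz Fyz; have FyFz := F_homo _ _ yz.
  have /andP[] := integral_transformed_density_bounds Fy0 yz.
  have /andP[] := level_transform_increment k_gt0 Fy0 FyFz (df_le1 z F_df).
  rewrite -/(g _) -/(g _) -/(h _) -/(h _) => g1 g2.
  have := @integral_ge0 _ _ _ mu `]y, z] (fun t => (w t)%:E).
  (* The upper bound excludes [+oo] and nonnegativity excludes [-oo], so the integral is a real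
     [I]. *)
  case: (\int[mu]_(t in _) _)%E => [I| |]; last 2 first.
  - by move=> _ _; rewrite leNgt ltry.
  - by move=> /(_ _) h0; have := h0 (fun x _ => transformed_density_ge0 x).
  move=> _; rewrite !lee_fin => I1 I2; exists I => //.
  have hle : h (F z) <= h (F y) by exact: level_density_nincr.
  have : (h (F y) - h (F z)) * (F z - F y) <= (h (F y) - h (F z)) * d.
    by rewrite ler_wpM2l// subr_ge0.
  by rewrite ler_norml; lra.
elim: i x => [|i IH] x ax.
  by rewrite mul0r addr0 => Fx; apply: step => //; rewrite Fx subrr.
move=> Fx.
(* Continuity of [F] provides the cut: the partition is uniform in the levels, not in [t]. *)
have [y ayx Fy] : exists2 y, y \in `[a, x] & F y = F a + i%:R * d.
  apply: IVT => //.
    by apply: continuous_subspaceT; exact: pdf_df_continuous F_pdf.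
  have -> : F a <= F x -> Num.min (F a) (F x) = F a by move=> ?; exact: min_l.
    rewrite lerDl mulr_ge0//= le_max; apply/orP; right.
    by rewrite Fx lerD2l ler_wpM2r// ler_nat.
  exact: F_homo.
move: ayx; rewrite in_itv/= => /andP[ay yx].
have [I1 I1E I1le] := IH y ay Fy.
have [||I2 I2E I2le] := step y x _ yx.
- by apply: lt_le_trans Fa0 _; exact: F_homo.
- by rewrite Fx Fy -natr1; lra.
exists (I1 + I2); first by rewrite (integral_transformed_density_split ay yx) I1E I2E.
have -> : I1 + I2 - (g (F x) - g (F a)) =
    (I1 - (g (F y) - g (F a))) + (I2 - (g (F x) - g (F y))) by ring.
by rewrite (le_trans (ler_normD _ _))//; lra.
Qed.

(** With [n.+1] equal level steps the error is at most [(h (F a) - h (F b)) * (F b - F a) / n.+1],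
    for every [n]. *)
Lemma integral_transformed_density_oc a b : 0 < F a -> a <= b ->
  (\int[mu]_(t in `]a, b]) (w t)%:E = (g (F b) - g (F a))%:E)%E.
Proof.
move=> Fa0 ab; have [F_homo _ _ _] := F_df; have Fab := F_homo _ _ ab.
have tel n : exists2 I, (\int[mu]_(t in `]a, b]) (w t)%:E = I%:E)%E &
    `|I - (g (F b) - g (F a))| <= (h (F a) - h (F b)) * ((F b - F a) / n.+1%:R).
  apply: (@integral_transformed_density_telescope _ _ n.+1) => //.
    by rewrite divr_ge0// subr_ge0.
  by rewrite mulrC divfK ?pnatr_eq0// addrC subrK.
have [I IE _] := tel 0%N; rewrite IE; congr (_%:E); apply/eqP.
rewrite -subr_eq0 -normr_le0.
have cv : (h (F a) - h (F b)) * ((F b - F a) / n.+1%:R) @[n --> \oo] --> (0 : R).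
  rewrite -(mulr0 (h (F a) - h (F b))); apply: cvgMr.
  rewrite -(mulr0 (F b - F a)); apply: cvgMr.
  exact: cvg_harmonic.
apply: (cvgr_to_ge cv); apply: nearW => n.
by have [J JE Jle] := tel n; move: JE; rewrite IE => -[->].
Qed.

End density_of_the_transform.

(** * The transform as a distribution function *)

Section transformed_df.
Context {R : realType}.
Variables (k : nat) (F f : R -> R).
Hypotheses (k_gt0 : (0 < k)%N) (F_df : is_df F) (F_pdf : has_pdf F f).
Let mu := @lebesgue_measure R.
Let w t := level_density k (F t) * f t.

Lemma U_level_transform x : U k F x = level_transform k (F x).
Proof. by []. Qed.

Lemma u_level_density : u k F f = w.
Proof.
apply/funext => x; rewrite /u /w /level_density.
case: ifP => _; last by rewrite mul0r.
by rewrite /texp [_ * f x / _]mulrAC [LHS]mulrAC.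
Qed.

(** [level_density] is unbounded near level 0, so the half-line is exhausted from points [a n] with
    [F (a n) = F x / n.+1]: monotone convergence on one side, continuity of [level_transform] at 0
    on the other. Where [F] is 0 the density vanishes. *)
Lemma integral_transformed_density_Nyc x :
  (\int[mu]_(t in `]-oo, x]) (w t)%:E = (level_transform k (F x))%:E)%E.
Proof.
have [F_homo _ F0 _] := F_df; have cF := pdf_df_continuous F_pdf.
have := df_ge0 x F_df; rewrite le_eqVlt => /predU1P[Fx0|Fx0].
  rewrite -Fx0 level_transform_le0// integral0_eq// => t; rewrite /= in_itv/= => tx.
  suff -> : w t = 0 by [].
  have Ft0 : F t = 0.
    by apply/eqP; rewrite eq_le df_ge0// andbT; apply: (le_trans (F_homo _ _ tx)); rewrite -Fx0.
  by rewrite /w /level_density Ft0 ltxx mul0r.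
have xE n : exists2 a, a <= x & F a = F x / n.+1%:R.
  have Fxn : 0 < F x / n.+1%:R by rewrite divr_gt0.
  have [z Fz] : exists z, F z < F x / n.+1%:R.
    exact: (@filter_ex _ _ _ _ (cvgr_lt _ F0 _ Fxn)).
  have Fn : F x / n.+1%:R <= F x by rewrite ler_pdivrMr// ler_peMr ?ler1n// ltW.
  have zx : z <= x by apply/ltW/(df_lt_inv F_df); exact: lt_le_trans Fn.
  have [||a azx Fa] := @IVT R F z x (F x / n.+1%:R) zx.
  - exact: continuous_subspaceT.
  - by rewrite ge_min le_max (ltW Fz) Fn orbT.
  by exists a => //; move: azx; rewrite in_itv/= => /andP[].
pose a n := sval (cid2 (xE n)).
have ax n : a n <= x by rewrite /a; case: cid2.
have Fa n : F (a n) = F x / n.+1%:R by rewrite /a; case: cid2.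
have Fa0 n : 0 < F (a n) by rewrite Fa divr_gt0.
have a_nincr : {homo a : m n / (m <= n)%N >-> n <= m}.
  apply/nonincreasing_seqP => n; apply/ltW/(df_lt_inv F_df).
  by rewrite !Fa ltr_pM2l// ltf_pV2 ?posrE// ltr_nat.
pose E n := `]a n, x]%classic.
have EU : \bigcup_n E n = [set t | t <= x /\ 0 < F t].
  apply/seteqP; split => t /=.
    move=> [n _]; rewrite /E/= in_itv/= => /andP[/ltW at_ tx]; split=> //.
    by apply: lt_le_trans (Fa0 n) _; exact: F_homo.
  (* For this [n], [F x / F t < n.+1], that is [F (a n) < F t]. *)
  move=> [tx Ft]; exists (Num.truncn (F x / F t)) => //; rewrite /E/= in_itv/= tx andbT.
  apply: (df_lt_inv F_df); rewrite Fa ltr_pdivrMr// mulrC -ltr_pdivrMr//.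
  exact: truncnS_gt.
have -> : (\int[mu]_(t in `]-oo, x]) (w t)%:E = \int[mu]_(t in \bigcup_n E n) (w t)%:E)%E.
  have -> : \bigcup_n E n = `]-oo, x]%classic `&` [set t | 0 < F t].
    by rewrite EU; apply/seteqP; split => t /=; rewrite in_itv.
  rewrite integral_mkcondr; apply: eq_integral => t _.
  rewrite patchE; case: ifPn => //; rewrite notin_setE/= => /negP.
  by rewrite /w /level_density => /negbTE ->; rewrite mul0r.
have mw D : measurable_fun D (fun t => (w t)%:E).
  exact: (measurable_transformed_density k F_df F_pdf).
have cvFa : F (a n) @[n --> \oo] --> (0 : R).
  under eq_fun do rewrite Fa.
  by rewrite -(mulr0 (F x)); apply: cvgMr; exact: cvg_harmonic.
have cv1 : (\int[mu]_(t in E n) (w t)%:E)%E @[n --> \oo] -->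
    (\int[mu]_(t in \bigcup_n E n) (w t)%:E)%E.
  apply: ge0_nondecreasing_set_cvg_integral => //.
  - move=> m n mn; apply/subsetPset => t; rewrite /E/= !in_itv/= => /andP[amt ->].
    by rewrite andbT (le_lt_trans _ amt)// a_nincr.
  - by move=> n; exact: measurable_itv.
  - by move=> n; exact: mw.
  - by move=> n t _; rewrite lee_fin (transformed_density_ge0 k F_pdf).
have cv2 : (\int[mu]_(t in E n) (w t)%:E)%E @[n --> \oo] -->
    (level_transform k (F x))%:E.
  under eq_fun => n do rewrite (integral_transformed_density_oc k_gt0 F_df F_pdf (Fa0 n) (ax n)).
  apply: cvg_EFin; first exact: nearW.
  rewrite -[X in _ --> X]subr0; apply: cvgB; first exact: cvg_cst.
  rewrite -(@level_transform_le0 R k 0)//.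
  apply: (@cvg_comp _ _ _ (fun n => F (a n)) (level_transform k) \oo (nbhs (0 : R))); last first.
    by apply: continuous_level_transform => //; rewrite lexx ltr01.
  exact: cvFa.
exact: cvg_unique cv1 cv2.
Qed.

Lemma has_pdf_U : has_pdf (U k F) (u k F f).
Proof.
split.
- rewrite u_level_density; have [mf _ _] := F_pdf.
  by apply: measurable_funM => //; exact: (measurable_level_density_df k F_df).
- by move=> x; rewrite u_level_density; exact: transformed_density_ge0.
- by move=> x; rewrite u_level_density integral_transformed_density_Nyc.
Qed.

Lemma is_df_U : is_df (U k F).
Proof.
have [F_homo F_rc F0 F1] := F_df.
have cF := pdf_df_continuous F_pdf.
split.
- move=> x y xy; apply: level_transform_ndecr => //; first exact: df_ge0.
    exact: F_homo.
  exact: df_le1.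
(* Continuity of [level_transform] is known on [[0, 1[]; where [F x = 1], [F] and its transform stay
   equal to 1 on the right. *)
- move=> x; have := df_le1 x F_df; rewrite le_eqVlt => /predU1P[Fx|Fx]; last first.
    apply: cvg_at_right_filter; rewrite U_level_transform.
    apply: (@cvg_comp _ _ _ F (level_transform k) (nbhs x) (nbhs (F x))).
      exact: cF.
    by apply: continuous_level_transform => //; rewrite df_ge0.
  rewrite U_level_transform Fx level_transform1//.
  apply: cvg_near_cst; near=> y; rewrite U_level_transform.
  suff -> : F y = 1 by rewrite level_transform1.
  apply/eqP; rewrite eq_le df_le1//= -Fx; apply: F_homo.
  by apply: ltW; near: y; exact: nbhs_right_gt.
- rewrite -(@level_transform_le0 R k 0)//.
  apply: (@cvg_comp _ _ _ F (level_transform k) _ (nbhs (0 : R))) => //.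
  by apply: continuous_level_transform => //; rewrite lexx ltr01.
- apply: level_transform_cvg1 => //.
  by apply: nearW => x; exact: df_le1.
Unshelve. all: by end_near. Qed.

Lemma is_df_H : is_df (H k F).
Proof.
have [F_homo F_rc F0 F1] := F_df.
have cvH (G : set_system R) (FG : Filter G) l : F @ G --> l -> H k F @ G --> 1 - (1 - l) ^+ k.
  move=> Fl; apply: cvgB; first exact: cvg_cst.
  by apply: cvgr_exprn; apply: cvgB => //; exact: cvg_cst.
split.
- move=> x y xy; rewrite lerD2l lerN2 lerXn2r ?nnegrE ?subr_ge0 ?df_le1//.
  by rewrite lerD2l lerN2 F_homo.
- by move=> x; apply: cvH; exact: F_rc.
- have -> : (0 : R) = 1 - (1 - 0) ^+ k by rewrite subr0 expr1n subrr.
  exact: cvH.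
- have -> : (1 : R) = 1 - (1 - 1) ^+ k by rewrite subrr expr0n gtn_eqF// subr0.
  exact: cvH.
Qed.

Lemma right_end_U : right_end (U k F) = right_end F.
Proof.
congr (ereal_sup (_ @` _)); apply/seteqP; split => x /=;
  by rewrite U_level_transform level_transform_lt1// df_ge0// df_le1.
Qed.

Lemma right_end_H : right_end (H k F) = right_end F.
Proof.
congr (ereal_sup (_ @` _)); apply/seteqP; split => x /=;
  rewrite /H ltrBlDr ltrDl => F1; last by rewrite exprn_gt0// subr_gt0.
rewrite lt_neqAle df_le1// andbT; apply: contraTneq F1 => ->.
by rewrite subrr expr0n gtn_eqF// ltxx.
Qed.

End transformed_df.

(** * Sequences *)

Section sequences.
Context {R : realType}.
Implicit Types (u v e p : R^nat) (l m c : R).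

Lemma cvg_near_lt u v l m : u @ \oo --> l -> v @ \oo --> m -> l < m ->
  \forall n \near \oo, u n < v n.
Proof.
move=> ul vm lm; near=> n; apply: (@lt_trans _ _ ((l + m) / 2)).
  by near: n; apply: (cvgr_lt _ ul); lra.
by near: n; apply: (cvgr_gt _ vm); lra.
Unshelve. all: by end_near. Qed.

Lemma cvgy_inv u : u @ \oo --> +oo -> (u n)^-1 @[n --> \oo] --> (0 : R).
Proof.
move=> uy; apply/cvgrPdist_le => e e0; near=> n; rewrite sub0r normrN.
have un : e^-1 < u n by near: n; move/cvgryPgt : uy; apply.
have un0 : 0 < u n by apply: lt_trans un; rewrite invr_gt0.
by rewrite ger0_norm ?invr_ge0 ?(ltW un0)// invf_ple ?posrE// ltW.
Unshelve. all: by end_near. Qed.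

(* [exp (- (1 - p) / p) <= p <= exp (- (1 - p))] *)
Lemma cvg_expr_expR (N : nat -> nat) p c :
  (\forall n \near \oo, 0 <= p n <= 1) -> p @ \oo --> (1 : R) ->
  (N n)%:R * (1 - p n) @[n --> \oo] --> c ->
  p n ^+ N n @[n --> \oo] --> expR (- c).
Proof.
move=> p01 p1 Npc.
have cE v : v @ \oo --> c -> expR (- v n) @[n --> \oo] --> expR (- c).
  move=> vc; apply: (cvg_comp (fun n => - v n) expR); last exact: continuous_expR.
  exact: cvgN.
apply: (@squeeze_cvgr _ _ _ _ (fun n => expR (- ((N n)%:R * (1 - p n) * (p n)^-1)))
  (fun n => expR (- ((N n)%:R * (1 - p n))))).
- near=> n.
  have p0 : 0 < p n by near: n; exact: (cvgr_gt _ p1 _ ltr01).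
  rewrite -mulrA -!mulrN !expRM_natl !lerXn2r ?nnegrE ?expR_ge0 ?(ltW p0)//.
    by have := expR_ge1Dx (- (1 - p n)); rewrite opprB addrC subrK.
  rewrite mulrN expRN -[leRHS]invrK lef_pV2 ?posrE ?invr_gt0 ?expR_gt0//.
  have := expR_ge1Dx ((1 - p n) / p n).
  by rewrite mulrBl mul1r divff ?gt_eqF// addrC subrK.
- apply: (cE (fun n => (N n)%:R * (1 - p n) * (p n)^-1)).
  rewrite -[c]mulr1; apply: cvgM => //; rewrite -[X in _ --> X]invr1.
  by apply: cvgV => //; exact: oner_neq0.
- exact: cE.
Unshelve. all: by end_near. Qed.

(** Each halving of the index contracts by [q < 1] up to a small error, so [e n <= L + M * q ^ j] as
    soon as [n] is large enough to be halved [j] times. It serves to compare norming constants at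
    [n] and [n./2]. *)
Lemma halving_contraction e r d (rho : R) : (forall n, 0 <= e n) -> rho < 1 ->
  r @ \oo --> rho -> d @ \oo --> (0 : R) ->
  (\forall n \near \oo, e n <= r n * e n./2 + d n) -> e @ \oo --> (0 : R).
Proof.
move=> e0 rho1 rrho d0 er.
(* Strictly between [rho] and 1, and positive even when [rho] is not. *)
pose q := (1 + Num.max rho 0) / 2.
have mx1 : Num.max rho 0 < 1 by rewrite gt_max rho1 ltr01.
have mx0 : 0 <= Num.max rho 0 by rewrite le_max lexx orbT.
have mxr : rho <= Num.max rho 0 by rewrite le_max lexx.
have q0 : 0 < q by rewrite /q; lra.
have q1 : q < 1 by rewrite /q; lra.
have qr : rho < q by rewrite /q; lra.
apply/cvgrPdist_le => eps eps0.
(* Chosen so that [L = eps / 2] is the fixed point of multiplication by [q] followed by adding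
   [del]. *)
pose del := eps * (1 - q) / 2.
have del0 : 0 < del by rewrite divr_gt0// mulr_gt0// subr_gt0.
have : \forall n \near \oo, e n <= q * e n./2 + del.
  near=> n; have h : e n <= r n * e n./2 + d n by near: n.
  apply: (le_trans h); apply: lerD.
    by rewrite ler_wpM2r//; apply: ltW; near: n; exact: (cvgr_lt _ rrho).
  by apply: ltW; near: n; exact: (cvgr_lt _ d0).
move=> [N0 _ hN].
have {}hN n : (N0 <= n)%N -> e n <= q * e n./2 + del by exact: hN.
pose N := N0.+1.
pose L := eps / 2.
have LE : L = q * L + del by rewrite /del /L; field.
(* Dominates each [e i] with [i < N], the base of the strong induction; [N > 0] makes [n./2 < n]
   beyond it. *)
pose M := \sum_(i < N) e i.
have M0 : 0 <= M by exact: sumr_ge0.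
have eM n : e n <= L + M.
  elim/ltn_ind: n => n IH; have [nN|Nn] := ltnP n N.
    rewrite -[leLHS]add0r lerD ?divr_ge0 ?(ltW eps0)//.
    by rewrite /M (bigD1 (Ordinal nN))//= lerDl sumr_ge0.
  have n0 : (0 < n)%N by exact: leq_ltn_trans Nn.
  apply: (le_trans (hN _ (ltnW Nn))).
  apply: (@le_trans _ _ (q * (L + M) + del)).
    rewrite lerD2r ler_pM2l//; apply: IH.
    by rewrite ltn_half_double -addnn -{1}[n]addn0 ltn_add2l.
  by rewrite mulrDr addrAC -LE lerD2l ler_piMl// ltW.
have ej j : exists K, forall n, (K <= n)%N -> e n <= L + M * q ^+ j.
  elim: j => [|j [K IH]]; first by exists 0%N => n _; rewrite expr0 mulr1.
  exists (maxn N0 K.*2) => n; rewrite geq_max => /andP[Nn Kn].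
  apply: (le_trans (hN _ Nn)).
  have Kn2 : (K <= n./2)%N by rewrite -[K]doubleK half_leq.
  rewrite LE -addrA [del + _]addrC addrA lerD2r exprS [M * _]mulrCA -mulrDr.
  by rewrite ler_pM2l// IH.
have /cvgrPdist_lt/(_ (L / (M + 1))) : q ^+ j @[j --> \oo] --> (0 : R).
  by apply: cvg_expr; rewrite ger0_norm// ltW.
have L0 : 0 < L by rewrite divr_gt0.
have M1 : 0 < M + 1 by rewrite ltr_wpDl.
rewrite divr_gt0// => /(_ isT) [j _ /(_ j (leqnn j))].
rewrite /= sub0r normrN ger0_norm ?exprn_ge0 ?(ltW q0)// => qj.
have [K hK] := ej j.
exists K => // n /= Kn; rewrite sub0r normrN ger0_norm//.
apply: (le_trans (hK n Kn)); rewrite [leRHS]splitr -/L lerD2l.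
apply: (@le_trans _ _ ((M + 1) * q ^+ j)); last first.
  by rewrite mulrC -ler_pdivlMr// ltW.
by rewrite ler_wpM2r ?exprn_ge0 ?(ltW q0)// lerDl.
Unshelve. all: by end_near. Qed.

End sequences.

(** * Tail quantiles *)

Section quantile.
Context {R : realType}.
Implicit Types x y : R.
Variables (F : R -> R).
Hypotheses (F_df : is_df F) (F_cont : continuous F).

(** Left of the infimum [F] is below [y], right of it at least [y]; continuity forces equality. *)
Lemma df_qinv y : 0 < y < 1 -> F (qinv F y) = y.
Proof.
move=> y01; have [F_homo _ F0 _] := F_df.
have /andP[y0 y1] := y01.
have [x0 Fx0] := df_IVT F_df F_cont y01.
have [a Fay] : exists a, F a < y by exact: (@filter_ex _ _ _ _ (cvgr_lt _ F0 _ y0)).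
have hinf : has_inf [set x | y <= F x].
  split; first by exists x0; rewrite /= Fx0.
  exists a => x /= yFx; apply/ltW/(df_lt_inv F_df); exact: lt_le_trans yFx.
apply/eqP; rewrite eq_le; apply/andP; split.
  apply: (cvgr_to_le (cvg_at_left_filter (F_cont (x := qinv F y)))).
  near=> x; have xq : x < qinv F y by near: x; exact: nbhs_left_lt.
  rewrite leNgt; apply/negP => yFx; move: xq; rewrite ltNge => /negP; apply.
  by apply: ge_inf; [case: hinf|exact: ltW].
apply: (cvgr_to_ge (cvg_at_right_filter (F_cont (x := qinv F y)))).
near=> x; have xq : qinv F y < x by near: x; exact: nbhs_right_gt.
have [s /= ys sx] := inf_lt hinf.1 xq.
by apply: (le_trans ys); apply: F_homo; exact: ltW.
Unshelve. all: by end_near. Qed.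

Lemma qinv_le y x : 0 < y < 1 -> y <= F x -> qinv F y <= x.
Proof.
move=> /andP[y0 _] yFx; have [_ _ F0 _] := F_df.
have [a Fay] : exists a, F a < y by exact: (@filter_ex _ _ _ _ (cvgr_lt _ F0 _ y0)).
apply: ge_inf => //; exists a => z /= yFz; apply/ltW/(df_lt_inv F_df).
exact: lt_le_trans yFz.
Qed.

Definition tail_quantile (s : R) := qinv F (1 - s^-1).
Local Notation V := tail_quantile.

Lemma onem_inv01 (s : R) : 1 < s -> 0 < 1 - s^-1 < 1.
Proof.
move=> s1; have s0 : 0 < s by exact: lt_trans s1.
by rewrite subr_gt0 invf_lt1// s1 ltrBlDr ltrDl invr_gt0.
Qed.

Lemma df_tail_quantile s : 1 < s -> F (V s) = 1 - s^-1.
Proof. by move=> s1; apply: df_qinv; exact: onem_inv01. Qed.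

Lemma tail_quantile_le s x : 1 < s -> (V s <= x) = (1 - s^-1 <= F x).
Proof.
move=> s1; apply/idP/idP; last by apply: qinv_le; exact: onem_inv01.
by rewrite -df_tail_quantile//; case: F_df => F_homo _ _ _ /F_homo.
Qed.

Lemma tail_quantile_gt s x : 1 < s -> (x < V s) = (F x < 1 - s^-1).
Proof. by move=> s1; rewrite !ltNge tail_quantile_le. Qed.

(** * Limits of normed tail quantiles *)

Section attraction.
Variables (a b : R^nat) (q : R -> R).
Hypothesis a_gt0 : forall n, 0 < a n.
Hypothesis cvg_powers : forall y, 0 < y ->
  F (a n * q y + b n) ^+ n @[n --> \oo] --> expR (- y^-1).
Hypothesis q_cont : forall y, 0 < y -> {for y, continuous q}.

(** By continuity [F (V s) = 1 - 1 / s] exactly, so [N * (1 - F (V s)) = N / s], which tends to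
    [1 / y]. *)
Lemma cvg_df_tail_quantile_pow (N : nat -> nat) (s : R^nat) y : 0 < y ->
  N @ \oo --> \oo -> s n / (N n)%:R @[n --> \oo] --> y ->
  F (V (s n)) ^+ N n @[n --> \oo] --> expR (- y^-1) /\ s @ \oo --> +oo.
Proof.
move=> y0 Ny sNy.
have NRy : (fun n => (N n)%:R : R) @ \oo --> +oo.
  exact: (cvg_comp N (fun n => n%:R : R) Ny (@cvgr_idn R)).
have sy : s @ \oo --> +oo.
  apply/cvgryPgt => A; near=> n.
  have N0 : 0 < (N n)%:R :> R by near: n; move/cvgryPgt : NRy; apply.
  have : y / 2 < s n / (N n)%:R by near: n; apply: (cvgr_gt _ sNy); lra.
  rewrite ltr_pdivlMr//; apply: le_lt_trans.
  rewrite -ler_pdivrMl; last lra.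
  by apply: ltW; near: n; move/cvgryPgt : NRy; apply.
split=> //; apply: cvg_expr_expR.
- by apply: nearW => n; rewrite df_ge0// df_le1.
- have : 1 - (s n)^-1 @[n --> \oo] --> (1 : R).
    by rewrite -[X in _ --> X]subr0; apply: cvgB; [exact: cvg_cst|exact: cvgy_inv].
  apply: cvg_trans; apply: near_eq_cvg; near=> n; rewrite df_tail_quantile//.
  by near: n; move/cvgryPgt : sy; apply.
- have : (s n / (N n)%:R)^-1 @[n --> \oo] --> y^-1 by apply: cvgV; rewrite ?gt_eqF.
  apply: cvg_trans; apply: near_eq_cvg; near=> n.
  rewrite df_tail_quantile; last by near: n; move/cvgryPgt : sy; apply.
  by rewrite opprB addrC subrK invfM invrK mulrC.
Unshelve. all: by end_near. Qed.

(** For [z < y < z'] the limits [exp (- 1 / z) < exp (- 1 / y) < exp (- 1 / z')] order the powers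
    strictly for large [n]; monotonicity of [F] transfers this to the arguments, and continuity of
    [q] closes the gap. *)
Lemma cvg_normed_tail_quantile (N : nat -> nat) (s : R^nat) y : 0 < y ->
  N @ \oo --> \oo -> s n / (N n)%:R @[n --> \oo] --> y ->
  (V (s n) - b (N n)) / a (N n) @[n --> \oo] --> q y.
Proof.
move=> y0 Ny sNy; have [FV sy] := cvg_df_tail_quantile_pow y0 Ny sNy.
have F_homo : {homo F : x y / x <= y} by case: F_df.
have FN z : 0 < z -> F (a (N n) * q z + b (N n)) ^+ N n @[n --> \oo] --> expR (- z^-1).
  by move=> z0; exact: (cvg_comp N (fun n => F (a n * q z + b n) ^+ n) Ny (cvg_powers z0)).
have lo z : 0 < z < y -> \forall n \near \oo, q z < (V (s n) - b (N n)) / a (N n).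
  move=> /andP[z0 zy]; have : expR (- z^-1) < expR (- y^-1).
    by rewrite ltr_expR ltrN2 ltf_pV2.
  move=> /(cvg_near_lt (FN z z0) FV); apply: filterS => n lt_pow.
  rewrite ltr_pdivlMr// ltrBrDr mulrC ltNge; apply/negP => le_V.
  by move: lt_pow; rewrite ltNge lerXn2r ?nnegrE ?df_ge0// F_homo.
have hi z : y < z -> \forall n \near \oo, (V (s n) - b (N n)) / a (N n) < q z.
  move=> yz; have z0 := lt_trans y0 yz.
  have : expR (- y^-1) < expR (- z^-1) by rewrite ltr_expR ltrN2 ltf_pV2.
  move=> /(cvg_near_lt FV (FN z z0)); apply: filterS => n lt_pow.
  rewrite ltr_pdivrMr// ltrBlDr mulrC ltNge; apply/negP => le_V.
  by move: lt_pow; rewrite ltNge lerXn2r ?nnegrE ?df_ge0// F_homo.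
apply/cvgrPdist_lt => e e0.
have qy := q_cont y0.
have [z /andP[zy qz]] : exists z, (0 < z < y) && (q y - e < q z).
  apply: (@filter_ex _ y^'-); near=> z; apply/andP; split.
    apply/andP; split; last by near: z; exact: nbhs_left_lt.
    by near: z; exact: nbhs_left_gt.
  near: z; apply: (cvgr_gt _ (cvg_at_left_filter qy)); lra.
have [z' /andP[zy' qz']] : exists z, (y < z) && (q z < q y + e).
  apply: (@filter_ex _ y^'+); near=> z'; apply/andP; split.
    by near: z'; exact: nbhs_right_gt.
  near: z'; apply: (cvgr_lt _ (cvg_at_right_filter qy)); lra.
near=> n; rewrite ltr_distlC; apply/andP; split.
  by apply: (lt_trans qz); near: n; exact: lo.
by apply: lt_trans qz'; near: n; exact: hi.
Unshelve. all: by end_near. Qed.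

End attraction.

(** [V (s * y) <= z] amounts to [s * (1 - F z) <= 1 / y], so the test points [1 / (c + e)] and
    [1 / (c - e)] enclose the tail. The last two hypotheses express that [q] crosses [xi] at
    [1 / c]. *)
Lemma cvg_tail_of_quantile (s z a b : R^nat) (q : R -> R) (xi c : R) :
  (forall n, 0 < a n) -> s @ \oo --> +oo -> 0 < c ->
  (forall y, 0 < y -> (V (s n * y) - b n) / a n @[n --> \oo] --> q y) ->
  (z n - b n) / a n @[n --> \oo] --> xi ->
  (forall y, 0 < y -> y < c^-1 -> q y < xi) ->
  (forall y, c^-1 < y -> xi < q y) ->
  s n * (1 - F (z n)) @[n --> \oo] --> c.
Proof.
move=> a0 sy c0 Vq zxi lo hi.
have sy1 y : 0 < y -> \forall n \near \oo, 1 < s n * y.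
  move=> y0; near=> n; rewrite -ltr_pdivrMr//.
  by near: n; move/cvgryPgt : sy; apply.
apply/cvgrPdist_le => e e0.
have : \forall n \near \oo, s n * (1 - F (z n)) <= c + e.
  have y0 : 0 < (c + e)^-1 by rewrite invr_gt0 addr_gt0.
  have yc : (c + e)^-1 < c^-1 by rewrite ltf_pV2 ?posrE ?addr_gt0// ltrDl.
  have /= Vz := cvg_near_lt (Vq _ y0) zxi (lo _ y0 yc).
  near=> n; have : (V (s n * (c + e)^-1) - b n) / a n < (z n - b n) / a n by near: n.
  rewrite ltr_pM2r ?invr_gt0// ltrD2r => /ltW.
  rewrite tail_quantile_le; last by near: n; exact: sy1.
  have sn : 0 < s n by near: n; move/cvgryPgt : sy; apply.
  rewrite invfM invrK lerBlDr -lerBlDl => h.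
  by apply: (le_trans (ler_wpM2l (ltW sn) h)); rewrite mulrA divff ?gt_eqF// mul1r.
have : \forall n \near \oo, c - e <= s n * (1 - F (z n)).
  have [ce|ce] := leP c e.
    near=> n; have sn : 0 < s n by near: n; move/cvgryPgt : sy; apply.
    apply: (@le_trans _ _ 0); first by rewrite subr_le0.
    by rewrite mulr_ge0 ?(ltW sn)// subr_ge0 df_le1.
  have ce0 : 0 < c - e by rewrite subr_gt0.
  have y0 : 0 < (c - e)^-1 by rewrite invr_gt0.
  have yc : c^-1 < (c - e)^-1 by rewrite ltf_pV2 ?posrE// ltrBlDr ltrDl.
  have /= Vz := cvg_near_lt zxi (Vq _ y0) (hi _ yc).
  near=> n; have : (z n - b n) / a n < (V (s n * (c - e)^-1) - b n) / a n by near: n.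
  rewrite ltr_pM2r ?invr_gt0// ltrD2r.
  rewrite tail_quantile_gt; last by near: n; exact: sy1.
  have sn : 0 < s n by near: n; move/cvgryPgt : sy; apply.
  rewrite invfM invrK ltrBrDr -ltrBrDl => /ltW h.
  by apply: le_trans (ler_wpM2l (ltW sn) h); rewrite mulrA divff ?gt_eqF// mul1r.
apply: filterS2 => n h1 h2; rewrite ler_distlC; lra.
Unshelve. all: by end_near. Qed.

End quantile.

(** * Tail of the transform *)

Section tail_of_the_transform.
Context {R : realType}.
Implicit Types (x y c : R) (F : R -> R).

(** The two bounds multiplied by [w ^ k]. Filter and weight are free because this serves both at the
    right endpoint, with [w = 1 / (1 - F)], and along sequences. *)
Lemma cvg_level_transform_tail {T : topologicalType} {G : set_system T} {FG : Filter G}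
    k (p w : T -> R) c : (0 < k)%N ->
  p @ G --> (1 : R) -> (\forall i \near G, p i <= 1) -> (\forall i \near G, 0 <= w i) ->
  w i * (1 - p i) @[i --> G] --> c ->
  w i ^+ k * (1 - level_transform k (p i)) @[i --> G] --> c ^+ k / k.+1`!%:R.
Proof.
move=> k0 p1 ple1 w0 wpc.
have wpk : (w i * (1 - p i)) ^+ k @[i --> G] --> c ^+ k by exact: cvgr_exprn.
apply: (@squeeze_cvgr _ _ _ _ (fun i => p i * (w i * (1 - p i)) ^+ k / k.+1`!%:R)
   (fun i => (w i * (1 - p i)) ^+ k / p i ^+ k / k.+1`!%:R)).
- near=> i.
  have p0 : 0 < p i by near: i; exact: (cvgr_gt _ p1 _ ltr01).
  have pi1 : p i <= 1 by near: i.
  have p01 : 0 < p i <= 1 by rewrite p0.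
  have wk0 : 0 <= w i ^+ k by rewrite exprn_ge0//; near: i.
  have /andP[lo hi] := level_transform_bounds k0 p01.
  rewrite exprMn; apply/andP; split.
    by apply: le_trans (ler_wpM2l wk0 lo); rewrite mulrCA !mulrA.
  by apply: (le_trans (ler_wpM2l wk0 hi)); rewrite !mulrA.
- apply: cvgMl; rewrite -[X in _ --> X]mul1r; exact: cvgM.
- apply: cvgMl; rewrite -[X in _ --> X]divr1; apply: cvgM => //.
  apply: cvgV; first exact: oner_neq0.
  by rewrite -(expr1n _ k); exact: cvgr_exprn.
Unshelve. all: by end_near. Qed.

Lemma cvg_df_of_tail F (s z : R^nat) c : s @ \oo --> +oo ->
  s n * (1 - F (z n)) @[n --> \oo] --> c -> F (z n) @[n --> \oo] --> (1 : R).
Proof.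
move=> sy sFc.
have : 1 - (s n)^-1 * (s n * (1 - F (z n))) @[n --> \oo] --> (1 : R).
  have := cvgB (cvg_cst (1 : R)) (cvgM (cvgy_inv sy) sFc).
  by rewrite mul0r subr0; apply.
apply: cvg_trans; apply: near_eq_cvg; near=> n.
have sn : 0 < s n by near: n; move/cvgryPgt : sy; apply.
by rewrite mulrA mulVf ?gt_eqF// mul1r opprB addrC subrK.
Unshelve. all: by end_near. Qed.

Lemma cvg_U_tail k F (s z : R^nat) c : (0 < k)%N -> is_df F ->
  s @ \oo --> +oo -> s n * (1 - F (z n)) @[n --> \oo] --> c ->
  s n ^+ k * (1 - U k F (z n)) @[n --> \oo] --> c ^+ k / k.+1`!%:R.
Proof.
move=> k0 F_df sy sFc.
apply: (@cvg_level_transform_tail _ _ _ k (fun n => F (z n)) s) => //.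
- exact: cvg_df_of_tail sy sFc.
- by apply: nearW => n; exact: df_le1.
- by near=> n; apply: ltW; near: n; move/cvgryPgt : sy; apply.
Unshelve. all: by end_near. Qed.

Lemma cvg_df_pow_of_tail F (z : R^nat) c : is_df F ->
  n%:R * (1 - F (z n)) @[n --> \oo] --> c -> F (z n) ^+ n @[n --> \oo] --> expR (- c).
Proof.
move=> F_df nFc; apply: (@cvg_expr_expR _ id (fun n => F (z n))) => //.
- by apply: nearW => n; rewrite df_ge0// df_le1.
- by apply: cvg_df_of_tail nFc; exact: cvgr_idn.
Qed.

(** The index at which the tail quantile of [F] is [qinv F (level k n)]; its [k]-th power
    [n / (k+1)!] absorbs the constant in the tail of [U]. *)
Definition rate k n : R := ((k.+1`!%:R / n%:R) `^ k%:R^-1)^-1.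

Lemma level_rate k n : level k n = 1 - (rate k n)^-1.
Proof. by rewrite /level /rate invrK. Qed.

Lemma rate_exprn k n : (0 < k)%N -> rate k n ^+ k = n%:R / k.+1`!%:R.
Proof.
move=> k0; rewrite /rate exprVn -powR_mulrn ?powR_ge0// -powRrM.
by rewrite mulVf ?pnatr_eq0 -?lt0n// powRr1 ?divr_ge0// invf_div.
Qed.

Lemma rate_pinfty k : (0 < k)%N -> rate k @ \oo --> +oo.
Proof.
move=> k0; apply/cvgryPgt => A; near=> n.
have r0 : 0 <= rate k n by rewrite invr_ge0 powR_ge0.
have [A0|A0] := ltP A 0; first exact: lt_le_trans r0.
rewrite -(@ltr_pXn2r _ k) ?nnegrE// rate_exprn// ltr_pdivlMr ?ltr0n ?fact_gt0//.
by near: n; exact: nbhs_infty_gtr.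
Unshelve. all: by end_near. Qed.

End tail_of_the_transform.

(** * Behaviour at the right endpoint *)

Section right_endpoint.
Context {R : realType}.
Implicit Types (x y : R) (F : R -> R).

#[local] Instance below_filter (r : \bar R) : Filter (below r).
Proof. by case: r => [r| |] /=; apply: filter_filter. Qed.

Variable F : R -> R.
Hypotheses (F_df : is_df F) (F_cont : continuous F).

(** By continuity [F < 1] is an open condition, so the supremum is not attained. *)
Lemma df_lt1_right_end x : (F x < 1) = (x%:E < right_end F)%E.
Proof.
apply/idP/idP => [Fx1|].
  have [y /andP[xy Fy]] : exists y, (x < y) && (F y < 1).
    apply: (@filter_ex _ x^'+); near=> y; apply/andP; split.
      by near: y; exact: nbhs_right_gt.
    by near: y; exact: (cvgr_lt _ (cvg_at_right_filter (F_cont (x := x)))).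
  apply: (@lt_le_trans _ _ y%:E); first by rewrite lte_fin.
  by apply: ereal_sup_ubound; exists y.
move=> /ereal_sup_gt[_ [y Fy <-]]; rewrite lte_fin => xy.
by apply: le_lt_trans Fy; case: F_df => + _ _ _; apply; exact: ltW.
Unshelve. all: by end_near. Qed.

Lemma right_end_neqNy : right_end F != -oo%E.
Proof.
have [_ _ F0 _] := F_df.
have [x] : exists x, F x < 1 by exact: (@filter_ex _ _ _ _ (cvgr_lt _ F0 _ ltr01)).
by rewrite df_lt1_right_end; case: (right_end F).
Qed.

Lemma df_ge_right_end x : (right_end F <= x%:E)%E -> F x = 1.
Proof.
rewrite leNgt -df_lt1_right_end -leNgt => F1.
by apply/eqP; rewrite eq_le F1 df_le1.
Qed.

Lemma near_below_lt1 : \forall x \near below (right_end F), F x < 1.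
Proof.
suff : \forall x \near below (right_end F), (x%:E < right_end F)%E.
  by apply: filterS => x; rewrite df_lt1_right_end.
have := right_end_neqNy; case: (right_end F) => [r| |]//= _.
  by apply: filterS (nbhs_left_lt r) => x; rewrite lte_fin.
by apply: (@filterS _ _ _ setT _ _ filterT) => x _; rewrite ltry.
Qed.

Lemma cvg_below_df : F x @[x --> below (right_end F)] --> (1 : R).
Proof.
have := right_end_neqNy; case E : (right_end F) => [r| |]//= _.
  have <- : F r = 1 by apply: df_ge_right_end; rewrite E.
  by apply: cvg_at_left_filter; exact: F_cont.
by case: F_df.
Qed.

(** [t n] eventually exceeds every [x] with [F x < 1], while [F (t n) < 1] keeps it left of the
    endpoint. This allows sequences to be substituted in limits at the endpoint. *)
Lemma cvg_below (t : R^nat) : F (t n) @[n --> \oo] --> (1 : R) ->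
  (\forall n \near \oo, F (t n) < 1) -> t @ \oo --> below (right_end F).
Proof.
move=> Ft1 Ft.
have gt x : F x < 1 -> \forall n \near \oo, x < t n.
  move=> Fx; near=> n; apply: (df_lt_inv F_df); near: n.
  exact: (cvgr_gt _ Ft1 _ Fx).
have := right_end_neqNy; case E : (right_end F) => [r| |]//= _.
  have tr : t @ \oo --> r.
    apply/cvgrPdist_lt => e e0; near=> n; rewrite ltr_distlC; apply/andP; split.
      by near: n; apply: gt; rewrite df_lt1_right_end E lte_fin gtrBl.
    have : F (t n) < 1 by near: n.
    by rewrite df_lt1_right_end E lte_fin => /lt_trans; apply; rewrite ltrDl.
  move=> A [e e0 hA]; move/cvgrPdist_lt : tr => /(_ e e0) tr.
  apply: filterS2 tr Ft => n /= tn Ftn; apply: hA => //=.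
  by move: Ftn; rewrite df_lt1_right_end E lte_fin.
apply/cvgryPgt => A; apply: gt.
by rewrite df_lt1_right_end E ltry.
Unshelve. all: by end_near. Qed.

Lemma cvg_U_ratio k : (0 < k)%N ->
  (1 - U k F x) / (1 - F x) ^+ k @[x --> below (right_end F)] --> (k.+1`!%:R^-1 : R).
Proof.
move=> k0.
have := @cvg_level_transform_tail R R (below (right_end F)) _ k F (fun x => (1 - F x)^-1) 1 k0.
move=> /(_ _ cvg_below_df); rewrite expr1n mul1r => h.
apply: cvg_trans (h _ _ _).
- apply: near_eq_cvg; near=> x; rewrite exprVn mulrC//.
- by apply: nearW => x; exact: df_le1.
- by apply: nearW => x; rewrite invr_ge0 subr_ge0 df_le1.
- apply: cvg_near_cst; near=> x; rewrite mulVf// subr_eq0 gt_eqF//.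
  by near: x; exact: near_below_lt1.
Unshelve. all: by end_near. Qed.

End right_endpoint.

Section tail_equivalence.
Context {R : realType}.
Variables (k : nat) (F f : R -> R).
Hypotheses (k_gt0 : (0 < k)%N) (F_df : is_df F) (F_pdf : has_pdf F f).

Lemma tail_equivalent_U_H : tail_equivalent (U k F) (H k F).
Proof.
split; first exact: is_df_U F_pdf.
- exact: is_df_H.
- by rewrite right_end_U// right_end_H.
exists k.+1`!%:R^-1; first by rewrite invr_gt0 ltr0n fact_gt0.
rewrite right_end_U//; under eq_fun do rewrite /H subKr.
by apply: cvg_U_ratio => //; exact: pdf_df_continuous F_pdf.
Qed.

End tail_equivalence.

(** * Comparison of norming constants at two indices *)

Section attraction_constants.
Context {R : realType}.
Implicit Types (x y c : R) (F G q : R -> R) (a b : R^nat).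

(** [N] indexes the constants and [s] the quantile; their freedom serves both the comparison of [n]
    with [2 n] and the truncation of real indices. *)
Definition normed_quantiles F a b q := forall (N : nat -> nat) (s : R^nat) y,
  0 < y -> N @ \oo --> \oo -> s n / (N n)%:R @[n --> \oo] --> y ->
  (tail_quantile F (s n) - b (N n)) / a (N n) @[n --> \oo] --> q y.

Lemma cvg_natr_pinfty (N : nat -> nat) :
  N @ \oo --> \oo -> (fun n => (N n)%:R : R) @ \oo --> +oo.
Proof. by move=> Ny; exact: (cvg_comp N (fun n => n%:R : R) Ny (@cvgr_idn R)). Qed.

Lemma cvg_double : double @ \oo --> \oo.
Proof.
move=> A [K _ hA]; exists K => // n /= Kn; apply: hA => /=.
by rewrite -addnn (leq_trans Kn)// leq_addr.
Qed.

Lemma cvg_half : half @ \oo --> \oo.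
Proof.
move=> A [K _ hA]; exists K.*2 => // n /= Kn; apply: hA => /=.
by rewrite -[K]doubleK half_leq.
Qed.

Lemma cvg_half_ratio : (n%:R / (n./2)%:R : R) @[n --> \oo] --> (2 : R).
Proof.
have h := cvgy_inv (cvg_natr_pinfty cvg_half).
apply: (@squeeze_cvgr _ _ _ _ (cst 2) (fun n => 2 + ((n./2)%:R)^-1)).
- near=> n.
  have n2 : 0 < (n./2)%:R :> R.
    by near: n; move/cvgryPgt : (cvg_natr_pinfty cvg_half); apply.
  rewrite ler_pdivlMr// ler_pdivrMr// [(2 + _) * _]mulrDl mulVf ?gt_eqF//=.
  rewrite -natrM natr1 !ler_nat mul2n -{2 3}[n]odd_double_half.
  by rewrite leq_addl/= -add1n leq_add2r leq_b1.
- exact: cvg_cst.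
- by have := cvgD (cvg_cst (2 : R)) h; rewrite addr0; apply.
Unshelve. all: by end_near. Qed.

(** A convergence of types: the quantiles at [M] and [2 M] are normed by the constants of [M] and by
    those of [N]. Differences eliminate [b] and give the ratio of scales; a single quantile then
    gives the shift. *)
Lemma normed_quantiles_ratio F a b q (N M : nat -> nat) : (forall n, 0 < a n) ->
  normed_quantiles F a b q -> q 2 != q 1 ->
  N @ \oo --> \oo -> M @ \oo --> \oo ->
  (M n)%:R / (N n)%:R @[n --> \oo] --> (2 : R) ->
  a (M n) / a (N n) @[n --> \oo] --> (q 4 - q 2) / (q 2 - q 1) /\
  (b (M n) - b (N n)) / a (N n) @[n --> \oo] -->
    q 2 - (q 4 - q 2) / (q 2 - q 1) * q 1.
Proof.
move=> a0 Vq q21 Ny My MN.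
have MN4 : 2 * (M n)%:R / (N n)%:R @[n --> \oo] --> (4 : R).
  have -> : (4 : R) = 2 * 2 by rewrite -natrM.
  by under eq_fun do rewrite -mulrA; exact: cvgMr.
have MM1 : (M n)%:R / (M n)%:R @[n --> \oo] --> (1 : R).
  apply: cvg_near_cst; near=> n; rewrite divff// gt_eqF//.
  by near: n; move/cvgryPgt : (cvg_natr_pinfty My); apply.
have MM2 : 2 * (M n)%:R / (M n)%:R @[n --> \oo] --> (2 : R).
  rewrite -[X in _ --> X]mulr1.
  by under eq_fun do rewrite -mulrA; exact: cvgMr.
have N4 := Vq N _ _ (ltr0Sn R 3) Ny MN4.
have N2 := Vq N _ _ (ltr0Sn R 1) Ny MN.
have M2 := Vq M _ _ (ltr0Sn R 1) My MM2.
have M1 := Vq M _ _ ltr01 My MM1.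
have q0 : q 2 - q 1 != 0 by rewrite subr_eq0.
have ratio : a (M n) / a (N n) @[n --> \oo] --> (q 4 - q 2) / (q 2 - q 1).
  pose W2 n := tail_quantile F (2 * (M n)%:R).
  pose W1 n := tail_quantile F (M n)%:R.
  have dM : (W2 n - b (M n)) / a (M n) - (W1 n - b (M n)) / a (M n) @[n --> \oo] -->
      q 2 - q 1 by exact: cvgB M2 M1.
  have dN : (W2 n - b (N n)) / a (N n) - (W1 n - b (N n)) / a (N n) @[n --> \oo] -->
      q 4 - q 2 by exact: cvgB N4 N2.
  apply: cvg_trans (cvgM dN (cvgV q0 dM)); apply: near_eq_cvg; near=> n => /=.
  have : (W2 n - b (M n)) / a (M n) - (W1 n - b (M n)) / a (M n) != 0.
    by near: n; exact: (cvgr_neq0 _ dM).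
  rewrite -mulrBl opprB addrA subrK mulf_eq0 => /norP[vw _].
  rewrite /unstable.inv_fun/=.
  by field; rewrite vw !gt_eqF.
split => //.
apply: cvg_trans (cvgB N2 (cvgM ratio M1)); apply: near_eq_cvg; near=> n => /=.
by rewrite !fctE/=; field; rewrite !gt_eqF.
Unshelve. all: by end_near. Qed.

End attraction_constants.

(** * Domains of attraction *)

Section extreme_value_laws.
Context {R : realType}.
Implicit Types (x y c alpha : R) (F G q : R -> R) (a b s : R^nat).

Lemma continuous_powRl x (r : R) : 0 < x -> {for x, continuous (fun t : R => t `^ r)}.
Proof.
move=> x0; apply/differentiable_continuous/derivable1_diffP.
by apply: derivable_powR; rewrite in_itv/= x0.
Qed.

Lemma continuous_expRN (f : R -> R) x : {for x, continuous f} ->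
  {for x, continuous (fun t : R => expR (- f t))}.
Proof.
move=> fx; apply: (cvg_comp (fun t => - f t) expR); last exact: continuous_expR.
exact: cvgN.
Qed.

Lemma near_eq_continuous (f g : R -> R) x : (\forall t \near x, f t = g t) ->
  {for x, continuous f} -> {for x, continuous g}.
Proof.
move=> fg cf; suff : g @ x --> g x by []; rewrite -(nbhs_singleton fg).
by apply: cvg_trans cf; exact: near_eq_cvg.
Qed.

Lemma continuous_Phi alpha x : 0 < x -> {for x, continuous (Phi alpha)}.
Proof.
move=> x0; apply: near_eq_continuous _ (continuous_expRN (@continuous_powRl x (- alpha) x0)).
by near=> t; rewrite /Phi ifT//; near: t; exact: lt_nbhsr.
Unshelve. all: by end_near. Qed.

Lemma continuous_Psi alpha x : x < 0 -> {for x, continuous (Psi alpha)}.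
Proof.
move=> x0; have Nx0 : 0 < `|x| by rewrite normr_gt0 lt_eqF.
have cx : {for x, continuous (fun t : R => `|t| `^ alpha)}.
  apply: (cvg_comp Num.norm (fun t => t `^ alpha)); last exact: continuous_powRl.
  exact: norm_continuous.
apply: near_eq_continuous _ (continuous_expRN cx).
by near=> t; rewrite /Psi ifT//; near: t; exact: lt_nbhsl.
Unshelve. all: by end_near. Qed.

Lemma continuous_Lambda : continuous (@Lambda R).
Proof.
move=> x; have idx : {for x, continuous (@id R)} by exact: cvg_id.
exact: (continuous_expRN (continuous_expRN idx)).
Qed.

Lemma Phi_powR alpha y : 0 < alpha -> 0 < y ->
  Phi alpha (y `^ alpha^-1) = expR (- y^-1).
Proof.
move=> al0 y0; rewrite /Phi powR_gt0// -powRrM mulrN mulVf ?gt_eqF//.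
by rewrite powR_inv1// ltW.
Qed.

Lemma Psi_powR alpha y : 0 < alpha -> 0 < y ->
  Psi alpha (- (y `^ (- alpha^-1))) = expR (- y^-1).
Proof.
move=> al0 y0; rewrite /Psi oppr_lt0 powR_gt0// normrN ger0_norm ?powR_ge0//.
by rewrite -powRrM mulNr mulVf ?gt_eqF// powR_inv1// ltW.
Qed.

Lemma Lambda_ln y : 0 < y -> Lambda (ln y) = expR (- y^-1).
Proof. by move=> y0; rewrite /Lambda -lnV ?posrE// lnK// posrE invr_gt0. Qed.

Lemma in_Dl_normed_quantiles F G q : is_df F -> continuous F -> in_Dl F G ->
  (forall y, 0 < y -> {for q y, continuous G}) ->
  (forall y, 0 < y -> G (q y) = expR (- y^-1)) ->
  (forall y, 0 < y -> {for y, continuous q}) ->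
  exists a b, (forall n, 0 < a n) /\ normed_quantiles F a b q.
Proof.
move=> F_df cF [a [b [a0 FG]]] cG Gq cq; exists a, b; split => // N s y y0 Ny sNy.
apply: cvg_normed_tail_quantile => // z z0.
by rewrite -Gq//; apply: FG; exact: cG.
Qed.

(** The integer part [T] of [s] provides the index of the constants, since
    [1 <= s / T <= 1 + 1 / T]. *)
Lemma cvg_truncn s : s @ \oo --> +oo ->
  (fun n => Num.truncn (s n)) @ \oo --> \oo /\
  forall y, s n * y / (Num.truncn (s n))%:R @[n --> \oo] --> y.
Proof.
move=> sy.
have Ty : (fun n => Num.truncn (s n)) @ \oo --> \oo.
  move=> A [K _ hA]; move/cvgryPge : sy => /(_ K%:R); apply: filterS => n Kn.
  by apply: hA; rewrite /= truncn_ge_nat// (le_trans _ Kn).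
split => // y.
have sT : s n / (Num.truncn (s n))%:R @[n --> \oo] --> (1 : R).
  have Tp : (fun n => (Num.truncn (s n))%:R : R) @ \oo --> +oo by exact: cvg_natr_pinfty.
  have iT := cvgy_inv Tp.
  move/cvgryPgt : Tp => Tp.
  apply: (@squeeze_cvgr _ _ _ _ (cst 1) (fun n => 1 + ((Num.truncn (s n))%:R)^-1)).
  - near=> n.
    have n2 : 0 < (Num.truncn (s n))%:R :> R.
      by near: n; exact: Tp.
    have s0 : 0 <= s n by near: n; move/cvgryPge : sy; apply.
    rewrite ler_pdivlMr// ler_pdivrMr// [(1 + _) * _]mulrDl mulVf ?gt_eqF//= !mul1r.
    by have /andP[h1 h2] := truncn_itv s0; rewrite h1 natr1 ltW.
  - exact: cvg_cst.
  - by have := cvgD (cvg_cst (1 : R)) iT; rewrite addr0; apply.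
rewrite -[X in _ --> X]mul1r; under eq_fun do rewrite mulrAC.
exact: cvgMl.
Unshelve. all: by end_near. Qed.

(** * The Frechet domain *)

Section frechet.
Variables (F : R -> R) (alpha : R).
Hypotheses (F_df : is_df F) (F_cont : continuous F) (alpha_gt0 : 0 < alpha).
Hypothesis F_Phi : in_Dl F (Phi alpha).

(** As [q 4 = (q 2) ^ 2] and [q 1 = 1], the limit shift vanishes and the scale grows by
    [A = 2 ^ (1 / alpha) > 1] from [n./2] to [n]. Hence [b n / a n] and [1 / a n] obey a contraction
    of ratio [A^-1]. *)
Lemma in_Dl_Phi_quantiles : exists a b, [/\ forall n, 0 < a n,
  normed_quantiles F a b (fun y => y `^ alpha^-1),
  b n / a n @[n --> \oo] --> (0 : R) & (a n)^-1 @[n --> \oo] --> (0 : R)].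
Proof.
have [||y y0|a [b [a0 Vq]]] := in_Dl_normed_quantiles F_df F_cont F_Phi
    (q := fun y => y `^ alpha^-1).
- by move=> y y0; apply: continuous_Phi; rewrite powR_gt0.
- by move=> y y0; rewrite Phi_powR.
- exact: continuous_powRl.
exists a, b.
pose A : R := 2 `^ alpha^-1.
have e1 : (1 : R) `^ alpha^-1 = 1 by rewrite powR1.
have A1 : 1 < A by rewrite -[X in X < _]e1 gt0_ltr_powR ?invr_gt0// ?nnegrE// ltr1n.
have q4 : 4 `^ alpha^-1 = A * A.
  by rewrite -powRM// -natrM.
have [||||ratio shift] := normed_quantiles_ratio (N := half) (M := id) a0 Vq.
- by rewrite powR1 -/A gt_eqF.
- exact: cvg_half.
- exact: cvg_id.
- exact: cvg_half_ratio.
move: ratio shift; rewrite powR1 q4 -/A.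
have -> : (A * A - A) / (A - 1) = A by field; rewrite subr_eq0 gt_eqF.
rewrite mulr1 subrr => ratio shift.
have inv_ratio : a n./2 / a n @[n --> \oo] --> A^-1.
  apply: cvg_trans (cvgV _ ratio); last by rewrite gt_eqF// (lt_trans ltr01).
  by apply: near_eq_cvg; near=> n; rewrite /= invf_div.
have iA1 : A^-1 < 1 by rewrite invf_lt1// (lt_trans ltr01).
split => //.
- apply/norm_cvg0P; apply: (halving_contraction _ iA1 inv_ratio
    (d := fun n => `|a n./2 / a n| * `|(b n - b n./2) / a n./2|)) => //.
  + by have := cvgM (cvg_norm inv_ratio) (cvg_norm shift); rewrite normr0 mulr0; apply.
  + near=> n => /=.
    rewrite -{1}[a n./2 / a n]ger0_norm ?divr_ge0 ?(ltW (a0 _))// -!normrM.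
    apply: le_trans (ler_normD _ _); rewrite le_eqVlt; apply/orP; left; apply/eqP.
    by congr (`|_|); field; rewrite !gt_eqF.
- apply: (halving_contraction _ iA1 inv_ratio (d := fun=> 0)) => //.
  + by move=> n; rewrite invr_ge0 ltW.
  + exact: cvg_cst.
  + by apply: nearW => n; rewrite addr0 mulrAC divff ?gt_eqF// mul1r.
Unshelve. all: by end_near. Qed.

(** Quantiles stay below a finite endpoint [r], so their quotient by [a n], which tends to 1, would
    be at most [r / a n], which tends to 0. *)
Lemma in_Dl_Phi_right_end : right_end F = +oo%E.
Proof.
have [a [b [a0 Vq ba ia]]] := in_Dl_Phi_quantiles.
have := right_end_neqNy F_df F_cont; case E : (right_end F) => [r| |]//= _.
have n1 : (n%:R / n%:R : R) @[n --> \oo] --> (1 : R).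
  by apply: cvg_near_cst; near=> n; rewrite divff// pnatr_eq0 -lt0n; near: n; exact: nbhs_infty_gt.
have V1 : (tail_quantile F n%:R - b n) / a n @[n --> \oo] --> (1 : R).
  by have := Vq id _ _ ltr01 cvg_id n1; rewrite powR1; apply.
have Va : (tail_quantile F n%:R - b n) / a n + b n / a n @[n --> \oo] --> (1 : R).
  by rewrite -[X in _ --> X]addr0; exact: cvgD.
have ra : r / a n @[n --> \oo] --> (0 : R).
  by rewrite -(mulr0 r); exact: cvgMr.
suff : (1 : R) <= 0 by rewrite leNgt ltr01.
apply: (ler_cvg_to Va ra); near=> n; rewrite -mulrDl subrK.
rewrite ler_pM2r ?invr_gt0//.
have n2 : 1 < n%:R :> R by rewrite ltr1n; near: n; exact: nbhs_infty_gt.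
rewrite -lee_fin; apply: ltW; rewrite -E -df_lt1_right_end// df_tail_quantile//.
by rewrite ltrBlDr ltrDl invr_gt0 (lt_trans _ n2).
Unshelve. all: by end_near. Qed.

(** The quantile is equivalent to the scale and [b] is negligible, so the point has normed position
    [x], which [q] attains at [x ^ alpha]. *)
Lemma in_Dl_Phi_tail s : s @ \oo --> +oo ->
  (\forall n \near \oo, 0 < tail_quantile F (s n)) /\
  forall x, 0 < x ->
    s n * (1 - F (tail_quantile F (s n) * x)) @[n --> \oo] --> x `^ (- alpha).
Proof.
move=> sy; have [a [b [a0 Vq ba ia]]] := in_Dl_Phi_quantiles.
have [Ty sT] := cvg_truncn sy.
have Vy y : 0 < y -> (tail_quantile F (s n * y) - b (Num.truncn (s n))) /
    a (Num.truncn (s n)) @[n --> \oo] --> y `^ alpha^-1.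
  by move=> y0; apply: Vq.
have baT : b (Num.truncn (s n)) / a (Num.truncn (s n)) @[n --> \oo] --> (0 : R).
  exact: (cvg_comp (fun n => Num.truncn (s n)) (fun n => b n / a n) Ty ba).
have Va : tail_quantile F (s n) / a (Num.truncn (s n)) @[n --> \oo] --> (1 : R).
  have : (tail_quantile F (s n * 1) - b (Num.truncn (s n))) / a (Num.truncn (s n)) +
      b (Num.truncn (s n)) / a (Num.truncn (s n)) @[n --> \oo] --> (1 : R).
    rewrite -[X in _ --> X]addr0; apply: cvgD => //.
    by have := Vy _ ltr01; rewrite powR1; apply.
  apply: cvg_trans; apply: near_eq_cvg; near=> n.
  by rewrite -mulrDl subrK mulr1.
split.
  near=> n; have : 0 < tail_quantile F (s n) / a (Num.truncn (s n)).
    by near: n; exact: (cvgr_gt _ Va _ ltr01).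
  by rewrite pmulr_lgt0// invr_gt0.
move=> x x0.
apply: (cvg_tail_of_quantile F_df F_cont (a := fun n => a (Num.truncn (s n)))
  (b := fun n => b (Num.truncn (s n))) (q := fun y => y `^ alpha^-1) (xi := x)) => //.
- by rewrite powR_gt0.
- have : tail_quantile F (s n) / a (Num.truncn (s n)) * x -
      b (Num.truncn (s n)) / a (Num.truncn (s n)) @[n --> \oo] --> x.
    by rewrite -[X in _ --> X]subr0 -[X in _ --> X - _]mul1r; apply: cvgB => //; exact: cvgMl.
  apply: cvg_trans; apply: near_eq_cvg; near=> n.
  by rewrite mulrBl mulrAC.
- move=> y y0; rewrite powRN invrK => yx.
  have -> : x = (x `^ alpha) `^ alpha^-1 by rewrite -powRrM divff ?gt_eqF// powRr1// ltW.
  by rewrite gt0_ltr_powR ?invr_gt0// nnegrE ?powR_ge0// ltW.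
- move=> y; rewrite powRN invrK => yx.
  have -> : x = (x `^ alpha) `^ alpha^-1 by rewrite -powRrM divff ?gt_eqF// powRr1// ltW.
  have y0 : 0 < y by apply: le_lt_trans yx; exact: powR_ge0.
  by rewrite gt0_ltr_powR ?invr_gt0// nnegrE ?powR_ge0// ltW.
Unshelve. all: by end_near. Qed.

End frechet.

End extreme_value_laws.

Section weibull_gumbel.
Context {R : realType}.
Implicit Types (x y c : R) (F G q : R -> R) (a b s : R^nat).
Variables (F : R -> R).
Hypotheses (F_df : is_df F) (F_cont : continuous F).

(** * The Weibull domain *)

Section weibull.
Variable alpha : R.
Hypotheses (alpha_gt0 : 0 < alpha) (F_Psi : in_Dl F (Psi alpha)).

(** Scales now shrink by [rho = 2 ^ (- 1 / alpha) < 1] under doubling and the shift is negligible,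
    so the drift of [b] is controlled by a geometric sum. Quantiles along [2 ^ J * n] pass every [x]
    with [F x < 1], which bounds the endpoint by [b n + K * a n] and makes it finite. *)
Lemma in_Dl_Psi_quantiles : exists a b r, [/\ forall n, 0 < a n,
  normed_quantiles F a b (fun y => - (y `^ (- alpha^-1))),
  right_end F = r%:E & (r - b n) / a n @[n --> \oo] --> (0 : R)].
Proof.
have [|||a [b [a0 Vq]]] := in_Dl_normed_quantiles F_df F_cont F_Psi
    (q := fun y => - (y `^ (- alpha^-1))).
- by move=> y y0; apply: continuous_Psi; rewrite oppr_lt0 powR_gt0.
- by move=> y y0; rewrite Psi_powR.
- by move=> y y0; apply: cvgN; exact: continuous_powRl.
pose rho : R := 2 `^ (- alpha^-1).
have e1 : (1 : R) `^ (- alpha^-1) = 1 by rewrite powR1.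
have rho0 : 0 < rho by rewrite powR_gt0.
have rho1 : rho < 1.
  rewrite /rho powRN invf_lt1 ?powR_gt0//.
  have {1}<- : (1 : R) `^ (alpha^-1) = 1 by rewrite powR1.
  by rewrite gt0_ltr_powR ?invr_gt0// ?nnegrE// ltr1n.
have q4 : 4 `^ (- alpha^-1) = rho * rho by rewrite -powRM// -natrM.
have n2 : ((n.*2)%:R / n%:R : R) @[n --> \oo] --> (2 : R).
  apply: cvg_near_cst; near=> n; rewrite -muln2 natrM mulrAC divff ?mul1r//.
  by rewrite pnatr_eq0 -lt0n; near: n; exact: nbhs_infty_gt.
have [||||ratio shift] := normed_quantiles_ratio (N := id) (M := double) a0 Vq.
- by rewrite e1 -/rho eqr_opp lt_eqF.
- exact: cvg_id.
- exact: cvg_double.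
- exact: n2.
move: ratio shift; rewrite e1 q4 -/rho.
have -> : (- (rho * rho) - - rho) / (- rho - - 1) = rho.
  by field; apply: lt0r_neq0; lra.
rewrite mulrN mulr1 opprK addNr => ratio shift.
have n1 : (n%:R / n%:R : R) @[n --> \oo] --> (1 : R).
  by apply: cvg_near_cst; near=> n; rewrite divff// pnatr_eq0 -lt0n; near: n; exact: nbhs_infty_gt.
have V1 : (tail_quantile F n%:R - b n) / a n @[n --> \oo] --> (-1 : R).
  by have := Vq id _ _ ltr01 cvg_id n1; rewrite e1; apply.
pose rho' := (1 + rho) / 2.
have rho'0 : 0 < rho' by rewrite /rho'; lra.
have rho'1 : rho' < 1 by rewrite /rho'; lra.
have rho'r : rho < rho' by rewrite /rho'; lra.
have upper (K : R) : 0 < K -> \forall n \near \oo, (right_end F <= (b n + K * a n)%:E)%E.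
  move=> K0.
  have step : \forall n \near \oo, [/\ a n.*2 <= rho' * a n,
      b n.*2 <= b n + K * (1 - rho') * a n & tail_quantile F n%:R <= b n].
    near=> n; split.
    - by rewrite -ler_pdivrMr//; apply: ltW; near: n; exact: (cvgr_lt _ ratio).
    - rewrite -lerBlDl -ler_pdivrMr//; apply: ltW; near: n; apply: (cvgr_lt _ shift).
      by rewrite mulr_gt0// subr_gt0.
    - rewrite -subr_le0 -(pmulr_lle0 _ (_ : 0 < (a n)^-1)) ?invr_gt0//.
      by apply: ltW; near: n; apply: (cvgr_lt _ V1); rewrite ltrN10.
  case: step => N0 _ step.
  (* [K = \sum_j K (1 - rho') rho'^j] absorbs the drift of [b] along [2 ^ J * n]. *)
  have climb J n : (N0 <= n)%N -> b (iter J double n) <= b n + K * a n.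
    elim: J n => [|J IH] n Nn; first by rewrite /= lerDl mulr_ge0// ltW.
    have [h1 h2 _] := step n Nn.
    have N2n : (N0 <= n.*2)%N by rewrite -addnn (leq_trans Nn)// leq_addr.
    rewrite iterSr; apply: (le_trans (IH _ N2n)).
    have := ler_wpM2l (ltW K0) h1; lra.
  near=> n; apply: ge_ereal_sup => _ [x Fx <-]; rewrite lee_fin.
  have Nn : (N0 <= n)%N by near: n; exact: nbhs_infty_ge.
  have n0 : (0 < n)%N by near: n; exact: nbhs_infty_gt.
  (* Then [2 ^ J * n > 1 / (1 - F x)], which puts [x] below the tail quantile of that index. *)
  pose J := (Num.truncn ((1 - F x)^-1)).+1.
  apply: le_trans (climb J n Nn).
  have iterE i : iter i double n = (2 ^ i * n)%N.
    by elim: i => [|i IH]; rewrite ?mul1n//= IH expnS -mul2n mulnA.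
  have NJ : (N0 <= iter J double n)%N.
    by rewrite iterE (leq_trans Nn)// leq_pmull// expn_gt0.
  have [_ _] := step _ NJ; apply: le_trans.
  have Fx0 : 0 < 1 - F x by rewrite subr_gt0.
  have J1 : (1 - F x)^-1 < (iter J double n)%:R.
    apply: (@lt_le_trans _ _ J%:R); first exact: truncnS_gt.
    rewrite ler_nat iterE (leq_trans (ltnW (ltn_expl J (ltnSn 1))))//.
    by rewrite leq_pmulr.
  apply/ltW; rewrite tail_quantile_gt//.
    by rewrite ltrBrDl -ltrBrDr invf_plt// ?posrE// (lt_trans _ J1)// invr_gt0.
  apply: le_lt_trans J1; rewrite invf_ge1//.
  by rewrite gerBl df_ge0.
have [r rE] : exists r, right_end F = r%:E.
  have [n Fn] : exists n, (right_end F <= (b n + 1 * a n)%:E)%E.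
    exact: (@filter_ex _ _ _ _ (upper 1 ltr01)).
  have := right_end_neqNy F_df F_cont; move: Fn; case: (right_end F) => [r| |]//= _ _.
  by exists r.
exists a, b, r; split => //.
apply/cvgrPdist_le => e e0.
(* Solves [q y = - (e / 2)]; the quantile of index [n * y] is below [r] and eventually above
   [b n - e * a n]. *)
pose y := (e / 2) `^ (- alpha).
have y0 : 0 < y by rewrite powR_gt0// divr_gt0.
have Vy : (tail_quantile F (n%:R * y) - b n) / a n @[n --> \oo] --> - (e / 2).
  have ny : (n%:R * y / n%:R) @[n --> \oo] --> y.
    apply: cvg_near_cst; near=> m; rewrite mulrAC divff ?mul1r//.
    by rewrite pnatr_eq0 -lt0n; near: m; exact: nbhs_infty_gt.
  have := Vq id _ _ y0 cvg_id ny; rewrite /y -powRrM mulrNN divff ?gt_eqF//.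
  by rewrite powRr1 ?divr_ge0 ?(ltW e0)//; apply.
near=> n; rewrite sub0r normrN ler_norml; apply/andP; split.
  apply: (@le_trans _ _ ((tail_quantile F (n%:R * y) - b n) / a n)).
    by apply: ltW; near: n; apply: (cvgr_gt _ Vy); lra.
  rewrite ler_pM2r ?invr_gt0// lerD2r -lee_fin -rE ltW//.
  have ny1 : 1 < n%:R * y by rewrite -ltr_pdivrMr//; near: n; exact: nbhs_infty_gtr.
  by rewrite -df_lt1_right_end// df_tail_quantile// ltrBlDr ltrDl invr_gt0 (lt_trans _ ny1).
rewrite ler_pdivrMr// lerBlDl -lee_fin -rE.
by near: n; exact: upper.
Unshelve. all: by end_near. Qed.

(** The distance from the quantile to [r] is equivalent to the scale and [r - b] is negligible, so
    the point has normed position [x]. *)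
Lemma in_Dl_Psi_tail s : s @ \oo --> +oo -> exists r, [/\ right_end F = r%:E,
  \forall n \near \oo, 0 < r - tail_quantile F (s n) &
  forall x, x < 0 ->
    s n * (1 - F ((r - tail_quantile F (s n)) * x + r)) @[n --> \oo] --> `|x| `^ alpha].
Proof.
move=> sy; have [a [b [r [a0 Vq rE rb]]]] := in_Dl_Psi_quantiles.
exists r; split => //.
  near=> n; have s1 : 1 < s n by near: n; move/cvgryPgt : sy; apply.
  rewrite subr_gt0 -lte_fin -rE -df_lt1_right_end// df_tail_quantile//.
  by rewrite ltrBlDr ltrDl invr_gt0 (lt_trans _ s1).
have [Ty sT] := cvg_truncn sy.
pose T n := Num.truncn (s n).
have Vy y : 0 < y -> (tail_quantile F (s n * y) - b (T n)) / a (T n) @[n --> \oo] -->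
    - (y `^ (- alpha^-1)).
  by move=> y0; apply: Vq.
have rbT : (r - b (T n)) / a (T n) @[n --> \oo] --> (0 : R).
  exact: (cvg_comp T (fun n => (r - b n) / a n) Ty rb).
have V1 : (tail_quantile F (s n * 1) - b (T n)) / a (T n) @[n --> \oo] --> (-1 : R).
  by have := Vy _ ltr01; rewrite powR1; apply.
move=> x x0; have Nx0 : 0 < `|x| by rewrite normr_gt0 lt_eqF.
have xE : x = - ((`|x| `^ - alpha) `^ (- alpha^-1)).
  rewrite -powRrM mulrNN divff ?gt_eqF// powRr1// ltr0_norm// opprK//.
apply: (cvg_tail_of_quantile F_df F_cont (a := fun n => a (T n))
  (b := fun n => b (T n)) (q := fun y => - (y `^ (- alpha^-1))) (xi := x)) => //.
- by rewrite powR_gt0.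
- have : ((r - b (T n)) / a (T n) - (tail_quantile F (s n * 1) - b (T n)) / a (T n)) * x +
      (r - b (T n)) / a (T n) @[n --> \oo] --> x.
    rewrite -[X in _ --> X]addr0; apply: cvgD => //.
    rewrite -[X in _ --> X]mul1r; apply: cvgMl.
    by have := cvgB rbT V1; rewrite sub0r opprK; apply.
  apply: cvg_trans; apply: near_eq_cvg; near=> n.
  by rewrite mulr1; field; rewrite gt_eqF.
- move=> y y0; rewrite -powRN => yx.
  rewrite [ltRHS]xE ltrN2 !(powRN _ alpha^-1) ltf_pV2 ?posrE ?powR_gt0//.
  by rewrite gt0_ltr_powR ?invr_gt0// nnegrE ?powR_ge0// ltW.
- move=> y; rewrite -powRN => yx.
  have y0 : 0 < y by apply: le_lt_trans yx; exact: powR_ge0.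
  rewrite [ltLHS]xE ltrN2 !(powRN _ alpha^-1) ltf_pV2 ?posrE ?powR_gt0//.
  by rewrite gt0_ltr_powR ?invr_gt0// nnegrE ?powR_ge0// ltW.
Unshelve. all: by end_near. Qed.

End weibull.

(** [z] is compared with quantiles of index [s * y] for [y] on either side of [1 / c]; it need not
    be a quantile itself, as [F] may have flat stretches. *)
Lemma cvg_quantile_of_tail (s z a b : R^nat) (q : R -> R) (c : R) :
  (forall n, 0 < a n) -> s @ \oo --> +oo -> 0 < c ->
  (forall y, 0 < y -> (tail_quantile F (s n * y) - b n) / a n @[n --> \oo] --> q y) ->
  {for c^-1, continuous q} ->
  s n * (1 - F (z n)) @[n --> \oo] --> c ->
  (z n - b n) / a n @[n --> \oo] --> q c^-1.
Proof.
move=> a0 sy c0 Vq cq sFc.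
have ic0 : 0 < c^-1 by rewrite invr_gt0.
apply/cvgrPdist_lt => e e0.
have [y /andP[/andP[y0 yc] qy]] : exists y, (0 < y < c^-1) && (q c^-1 - e < q y).
  apply: (@filter_ex _ (c^-1)^'-); near=> y; apply/andP; split.
    apply/andP; split; last by near: y; exact: nbhs_left_lt.
    by near: y; exact: nbhs_left_gt.
  near: y; apply: (cvgr_gt _ (cvg_at_left_filter cq)); lra.
have [y' /andP[yc' qy']] : exists y, (c^-1 < y) && (q y < q c^-1 + e).
  apply: (@filter_ex _ (c^-1)^'+); near=> y'; apply/andP; split.
    by near: y'; exact: nbhs_right_gt.
  near: y'; apply: (cvgr_lt _ (cvg_at_right_filter cq)); lra.
have y'0 : 0 < y' by exact: lt_trans yc'.
have sy1 w : 0 < w -> \forall n \near \oo, 1 < s n * w.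
  move=> w0; near=> n; rewrite -ltr_pdivrMr//.
  by near: n; move/cvgryPgt : sy; apply.
near=> n; have sn : 0 < s n by near: n; move/cvgryPgt : sy; apply.
rewrite ltr_distlC; apply/andP; split.
  apply: (@lt_le_trans _ _ ((tail_quantile F (s n * y) - b n) / a n)).
    by near: n; exact: (cvgr_gt _ (Vq _ y0)).
  rewrite ler_pM2r ?invr_gt0// lerD2r tail_quantile_le; [|by []|by []|]; last first.
    by near: n; exact: sy1.
  rewrite lerBlDr -lerBlDl invfM -ler_pdivrMl ?invr_gt0// invrK.
  apply: ltW; near: n; apply: (cvgr_lt _ sFc).
  by rewrite -[c]invrK ltf_pV2 ?posrE.
apply: (@lt_trans _ _ ((tail_quantile F (s n * y') - b n) / a n)); last first.
  by near: n; exact: (cvgr_lt _ (Vq _ y'0)).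
rewrite ltr_pM2r ?invr_gt0// ltrD2r tail_quantile_gt; [|by []|by []|]; last first.
  by near: n; exact: sy1.
rewrite ltrBrDr -ltrBrDl invfM -ltr_pdivlMl ?invr_gt0// invrK.
near: n; apply: (cvgr_gt _ sFc).
by rewrite -[c]invrK ltf_pV2 ?posrE.
Unshelve. all: by end_near. Qed.

(** The limit for [v] is assumed for [x >= 0] only. At index [1 / (1 - F t)] the point [t] has
    normed position 0 and [t + v t] has position 1, so [v t] is equivalent to the scale; then
    [t + v t * x] has position [x] for every real [x], negative ones included. *)
Lemma in_Dl_Lambda_tail (v : R -> R) (t : R^nat) : in_Dl F (@Lambda R) ->
  (forall x, 0 <= x ->
    (1 - F (t + v t * x)) / (1 - F t) @[t --> below (right_end F)] --> expR (- x)) ->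
  F (t n) @[n --> \oo] --> (1 : R) -> (\forall n \near \oo, F (t n) < 1) ->
  (fun n => (1 - F (t n))^-1) @ \oo --> +oo /\
  forall x, (1 - F (t n))^-1 * (1 - F (t n + v (t n) * x)) @[n --> \oo] --> expR (- x).
Proof.
move=> F_Lambda Fv Ft1 Ft.
have [|||a [b [a0 Vq]]] := in_Dl_normed_quantiles F_df F_cont F_Lambda (q := @ln R).
- by move=> y y0; exact: continuous_Lambda.
- exact: Lambda_ln.
- exact: continuous_ln.
have tr := cvg_below F_df F_cont Ft1 Ft.
pose s n := (1 - F (t n))^-1.
have sy : s @ \oo --> +oo.
  apply/cvgryPgt => A; near=> n.
  have F1 : 0 < 1 - F (t n) by rewrite subr_gt0; near: n.
  apply: (@le_lt_trans _ _ (Num.max A 1)); first by rewrite le_max lexx.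
  have A1 : 0 < Num.max A 1 by rewrite lt_max ltr01 orbT.
  rewrite /s invf_pgt ?posrE// ltrBlDr -ltrBlDl; near: n; apply: (cvgr_gt _ Ft1).
  by rewrite ltrBlDr ltrDl invr_gt0 lt_max ltr01 orbT.
split => //.
have [Ty sT] := cvg_truncn sy.
pose T n := Num.truncn (s n).
have Vy y : 0 < y -> (tail_quantile F (s n * y) - b (T n)) / a (T n) @[n --> \oo] --> ln y.
  by move=> y0; apply: Vq.
have tb : (t n - b (T n)) / a (T n) @[n --> \oo] --> (0 : R).
  rewrite -(ln1 R) -invr1; apply: (cvg_quantile_of_tail (s := s) (a := fun n => a (T n))) => //.
    by apply: continuous_ln; rewrite invr1.
  apply: cvg_near_cst; near=> n; rewrite mulVf// subr_eq0 gt_eqF//.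
  by near: n.
have sv x : 0 <= x -> s n * (1 - F (t n + v (t n) * x)) @[n --> \oo] --> expR (- x).
  move=> x0; have := cvg_comp t _ tr (Fv x x0).
  by under [X in X @ _]funext do rewrite /= mulrC.
have tvb : (t n + v (t n) * 1 - b (T n)) / a (T n) @[n --> \oo] --> (1 : R).
  rewrite [X in _ --> X](_ : 1 = ln (expR (- 1))^-1); last by rewrite -expRN opprK expRK.
  apply: (cvg_quantile_of_tail (s := s) (a := fun n => a (T n))) => //.
  - by apply: continuous_ln; rewrite invr_gt0 expR_gt0.
  - exact: sv.
move=> x; apply: (cvg_tail_of_quantile F_df F_cont (a := fun n => a (T n))
  (b := fun n => b (T n)) (q := @ln R) (xi := x)) => //.
- by rewrite expR_gt0.
- have : (t n - b (T n)) / a (T n) + ((t n + v (t n) * 1 - b (T n)) / a (T n) -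
      (t n - b (T n)) / a (T n)) * x @[n --> \oo] --> x.
    rewrite -[X in _ --> X]add0r; apply: cvgD => //.
    rewrite -[X in _ --> X]mul1r; apply: cvgMl.
    by have := cvgB tvb tb; rewrite subr0; apply.
  apply: cvg_trans; apply: near_eq_cvg; near=> n.
  by rewrite mulr1; field; rewrite gt_eqF.
- by move=> y y0; rewrite -expRN opprK => yx; rewrite -[ltRHS]expRK ltr_ln ?posrE ?expR_gt0.
- move=> y; rewrite -expRN opprK => yx; rewrite -[ltLHS]expRK ltr_ln ?posrE ?expR_gt0//.
  by apply: lt_trans yx; rewrite expR_gt0.
Unshelve. all: by end_near. Qed.

End weibull_gumbel.

(** * Norming constants of the transform *)

Section norming_constants.
Context {R : realType}.
Implicit Types (x y c : R).

(** [in_Dl] wants a positive scale at every index, [norming] only at large ones; the value 1 fills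
    the gap. *)
Lemma norming_in_Dl (F G : R -> R) (a b : R^nat) : norming F G a b -> in_Dl F G.
Proof.
move=> [a0 FG]; exists (fun n => if 0 < a n then a n else 1), b; split.
  by move=> n; case: ifPn.
move=> x _; apply: cvg_trans (FG x); apply: near_eq_cvg; near=> n.
by rewrite ifT//; near: n.
Unshelve. all: by end_near. Qed.

Variables (k : nat) (F f : R -> R).
Hypotheses (k_gt0 : (0 < k)%N) (F_df : is_df F) (F_pdf : has_pdf F f).

Let F_cont : continuous F := pdf_df_continuous F_pdf.
Let U_df : is_df (U k F) := is_df_U k_gt0 F_df F_pdf.

(** Since [n = (k+1)! * rate k n ^ k], the factorial cancels and [n * (1 - U)] tends to [c ^ k]. *)
Lemma cvg_U_pow (z : R^nat) c : rate k n * (1 - F (z n)) @[n --> \oo] --> c ->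
  U k F (z n) ^+ n @[n --> \oo] --> expR (- c ^+ k).
Proof.
move=> rFc; apply: cvg_df_pow_of_tail => //.
have fk0 : k.+1`!%:R != 0 :> R by rewrite pnatr_eq0 -lt0n fact_gt0.
have : rate k n ^+ k * (1 - U k F (z n)) * k.+1`!%:R @[n --> \oo] --> c ^+ k.
  rewrite -[X in _ --> X](divfK fk0); apply: cvgMl.
  by apply: cvg_U_tail => //; exact: rate_pinfty.
apply: cvg_trans; apply: near_eq_cvg; near=> n.
by rewrite rate_exprn// mulrAC divfK.
Unshelve. all: by end_near. Qed.

Lemma powR_exprn x (r : R) : (x `^ r) ^+ k = x `^ (k%:R * r).
Proof. by rewrite -powR_mulrn ?powR_ge0// -powRrM mulrC. Qed.

Lemma norming_U_Phi alpha : 0 < alpha -> in_Dl F (Phi alpha) ->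
  norming (U k F) (Phi (k%:R * alpha)) (fun n => qinv F (level k n)) (fun=> 0).
Proof.
move=> al0 FPhi.
have [V0 FV] := in_Dl_Phi_tail F_df F_cont al0 FPhi (rate_pinfty k_gt0).
have qE n : qinv F (level k n) = tail_quantile F (rate k n) by rewrite level_rate.
have pos x : 0 < x -> U k F (tail_quantile F (rate k n) * x) ^+ n @[n --> \oo] -->
    expR (- (x `^ (- (k%:R * alpha)))).
  by move=> x0; rewrite -mulrN -powR_exprn; apply: cvg_U_pow; exact: FV.
split; first by apply: filterS V0 => n; rewrite qE.
move=> x; under eq_fun do rewrite qE addr0.
rewrite /Phi; case: ltP => [|x0]; first exact: pos.
(* At [x <= 0] the power is dominated by its value at any [x' > 0], the scale being positive. *)
apply/cvgrPdist_lt => e e0.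
have ka0 : 0 < k%:R * alpha by rewrite mulr_gt0// ltr0n.
(* [Phi (k alpha) x' = exp (- 1 / e) < e] *)
pose x' := e `^ (k%:R * alpha)^-1.
have x'0 : 0 < x' by rewrite powR_gt0.
have le : expR (- (x' `^ (- (k%:R * alpha)))) < e.
  rewrite /x' -powRrM mulrN mulVf ?gt_eqF// powR_inv1 ?(ltW e0)// expRN invf_plt ?posrE ?expR_gt0//.
  by apply: lt_le_trans (expR_ge1Dx _); rewrite ltrDr.
near=> n; rewrite sub0r normrN ger0_norm ?exprn_ge0 ?df_ge0//.
have Vn : 0 < tail_quantile F (rate k n) by near: n.
apply: (@le_lt_trans _ _ (U k F (tail_quantile F (rate k n) * x') ^+ n)).
  rewrite lerXn2r ?nnegrE ?df_ge0//; case: U_df => + _ _ _; apply.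
  by rewrite ler_pM2l// (le_trans x0)// ltW.
by near: n; exact: (cvgr_lt _ (pos _ x'0)).
Unshelve. all: by end_near. Qed.

Lemma norming_U_Psi alpha : 0 < alpha -> in_Dl F (Psi alpha) ->
  norming (U k F) (Psi (k%:R * alpha))
    (fun n => fine (right_end F) - qinv F (level k n)) (fun=> fine (right_end F)).
Proof.
move=> al0 FPsi.
have [r [rE V0 FV]] := in_Dl_Psi_tail F_df F_cont al0 FPsi (rate_pinfty k_gt0).
have qE n : qinv F (level k n) = tail_quantile F (rate k n) by rewrite level_rate.
rewrite rE/=; split; first by apply: filterS V0 => n; rewrite qE.
move=> x; under eq_fun do rewrite qE.
rewrite /Psi; case: ltP => [x0|x0].
  by rewrite -powR_exprn; apply: cvg_U_pow; exact: FV.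
apply: cvg_near_cst; near=> n; rewrite U_level_transform.
have Vn : 0 < r - tail_quantile F (rate k n) by near: n.
have -> : F ((r - tail_quantile F (rate k n)) * x + r) = 1.
  by apply: df_ge_right_end => //; rewrite rE lee_fin lerDr mulr_ge0// ltW.
by rewrite level_transform1// expr1n.
Unshelve. all: by end_near. Qed.

Lemma in_Dl_Psi_right_end alpha : 0 < alpha -> in_Dl F (Psi alpha) ->
  (right_end F < +oo)%E.
Proof.
move=> al0 FPsi.
have [r [-> _ _]] := in_Dl_Psi_tail F_df F_cont al0 FPsi (rate_pinfty k_gt0).
by rewrite ltry.
Qed.

(** * The Gumbel case *)

Section gumbel.
Variable v : R -> R.
Hypothesis F_Lambda : in_Dl F (@Lambda R).
Hypothesis v_gt0 : forall t, (t%:E < right_end F)%E -> 0 < v t.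
Hypothesis Fv : forall x, 0 <= x ->
  (1 - F (t + v t * x)) / (1 - F t) @[t --> below (right_end F)] --> expR (- x).

Lemma near_inv_natr01 : \forall n \near \oo, 0 < 1 - (n%:R : R)^-1 < 1.
Proof.
near=> n; apply: onem_inv01; rewrite ltr1n; near: n; exact: nbhs_infty_gt.
Unshelve. all: by end_near. Qed.

Lemma cvg_inv_natr : 1 - (n%:R : R)^-1 @[n --> \oo] --> (1 : R).
Proof.
rewrite -[X in _ --> X]subr0; apply: cvgB; first exact: cvg_cst.
by apply: cvgy_inv; exact: cvgr_idn.
Qed.

Lemma norming_F_Lambda :
  norming F Lambda (fun n => v (qinv F (1 - n%:R^-1))) (fun n => qinv F (1 - n%:R^-1)).
Proof.
pose t n := qinv F (1 - n%:R^-1).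
have Ft : \forall n \near \oo, F (t n) = 1 - n%:R^-1.
  by apply: filterS near_inv_natr01 => n; exact: df_qinv.
have Flt1 : \forall n \near \oo, F (t n) < 1.
  by apply: filterS2 near_inv_natr01 Ft => n /andP[_ n1] ->.
have Ft1 : F (t n) @[n --> \oo] --> (1 : R).
  apply: cvg_trans cvg_inv_natr; apply: near_eq_cvg.
  by apply: filterS Ft => n ->.
have [_ FL] := in_Dl_Lambda_tail F_df F_cont F_Lambda Fv Ft1 Flt1.
split.
  by apply: filterS Flt1 => n; rewrite df_lt1_right_end//; exact: v_gt0.
move=> x; apply: cvg_df_pow_of_tail => //.
apply: cvg_trans (FL x); apply: near_eq_cvg; near=> n.
have -> : F (t n) = 1 - n%:R^-1 by near: n.
by rewrite subKr invrK [_ * x + _]addrC.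
Unshelve. all: by end_near. Qed.

(** The centre is a quantile of [U], so [n = 1 / (1 - U (t n))] and the limit sought is that of a
    ratio of two tails of [U]: the factorials cancel, and the [k]-th power turns [exp (- x / k)]
    into [exp (- x)]. *)
Lemma norming_U_Lambda :
  norming (U k F) Lambda (fun n => v (qinv (U k F) (1 - n%:R^-1)) / k%:R)
    (fun n => qinv (U k F) (1 - n%:R^-1)).
Proof.
have U_cont := pdf_df_continuous (has_pdf_U k_gt0 F_df F_pdf).
pose t n := qinv (U k F) (1 - n%:R^-1).
have Ut : \forall n \near \oo, U k F (t n) = 1 - n%:R^-1.
  by apply: filterS near_inv_natr01 => n; exact: df_qinv.
have Flt1 : \forall n \near \oo, F (t n) < 1.
  apply: filterS2 near_inv_natr01 Ut => n /andP[_ n1] Utn.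
  by rewrite -(@level_transform_lt1 _ k) ?df_ge0 ?df_le1// -U_level_transform Utn.
have Ut1 : U k F (t n) @[n --> \oo] --> (1 : R).
  apply: cvg_trans cvg_inv_natr; apply: near_eq_cvg.
  by apply: filterS Ut => n ->.
have Ft1 : F (t n) @[n --> \oo] --> (1 : R).
  apply/cvgrPdist_lt => e e0.
  (* [level_transform] maps [y < 1] below 1, so [U (t n)] eventually exceeds that image and
     [F (t n)] exceeds [y]. *)
  pose y := Num.max 0 (1 - e).
  have y0 : 0 <= y by rewrite le_max lexx.
  have y1 : y < 1 by rewrite gt_max ltr01 gtrBl.
  have gy1 : level_transform k y < 1 by rewrite level_transform_lt1 ?y0 ?ltW.
  near=> n; rewrite ger0_norm ?subr_ge0 ?df_le1//.
  suff yF : y < F (t n).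
    by rewrite ltrBlDr -ltrBlDl; apply: le_lt_trans yF; rewrite le_max lexx orbT.
  have : level_transform k y < U k F (t n) by near: n; exact: (cvgr_gt _ Ut1).
  rewrite !ltNge; apply: contra => Fy.
  by apply: level_transform_ndecr; rewrite ?df_ge0// ltW.
have [sy FL] := in_Dl_Lambda_tail F_df F_cont F_Lambda Fv Ft1 Flt1.
have k0 : k%:R != 0 :> R by rewrite pnatr_eq0 -lt0n.
have fk0 : k.+1`!%:R != 0 :> R by rewrite pnatr_eq0 -lt0n fact_gt0.
split.
  apply: filterS Flt1 => n; rewrite df_lt1_right_end// => tr.
  by rewrite divr_gt0 ?ltr0n//; exact: v_gt0.
move=> x; apply: cvg_df_pow_of_tail => //.
pose s n := (1 - F (t n))^-1.
have sU : s n ^+ k * (1 - U k F (t n)) @[n --> \oo] --> (k.+1`!%:R^-1 : R).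
  have -> : (k.+1`!%:R^-1 : R) = 1 ^+ k / k.+1`!%:R by rewrite expr1n mul1r.
  apply: cvg_U_tail => //.
  apply: cvg_near_cst; near=> n; rewrite mulVf// subr_eq0 gt_eqF//.
  by near: n.
have sUx : s n ^+ k * (1 - U k F (t n + v (t n) * (x / k%:R))) @[n --> \oo] -->
    expR (- x) / k.+1`!%:R.
  have -> : expR (- x) = expR (- (x / k%:R)) ^+ k.
    by rewrite -expRM_natl mulrN mulrC divfK.
  by apply: cvg_U_tail => //; exact: FL.
have ifk0 : (k.+1`!%:R : R)^-1 != 0 by rewrite invr_eq0.
have <- : expR (- x) / k.+1`!%:R / k.+1`!%:R^-1 = expR (- x) by rewrite invrK divfK.
apply: cvg_trans (cvgM sUx (cvgV ifk0 sU)); apply: near_eq_cvg; near=> n.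
have s0 : s n != 0.
  by rewrite invr_eq0 subr_eq0 gt_eqF//; near: n.
have n0 : n%:R != 0 :> R.
  by rewrite pnatr_eq0 -lt0n; near: n; exact: nbhs_infty_gt.
have -> : v (qinv (U k F) (1 - n%:R^-1)) / k%:R * x + qinv (U k F) (1 - n%:R^-1) =
    t n + v (t n) * (x / k%:R) by rewrite addrC mulrAC -mulrA.
rewrite /unstable.inv_fun/=.
have -> : U k F (t n) = 1 - n%:R^-1 by near: n.
rewrite subKr invfM invrK mulrACA divff ?expf_neq0// mul1r mulrC//.
Unshelve. all: by end_near. Qed.

End gumbel.
End norming_constants.

Unset Implicit Arguments.
Theorem theorem3p3 (R : realType) (k : nat) (F f : R -> R)
    (k_gt0 : (0 < k)%N) (F_df : is_df F) (F_pdf : has_pdf F f) :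
  (* (a) *)
  [/\ is_df (U k F), right_end (U k F) = right_end F &
      has_pdf (U k F) (u k F f)] /\
  (* (b) *)
  ((1 - U k F x) / (1 - F x) ^+ k @[x --> below (right_end F)]
     --> ((k.+1)`!%:R^-1 : R) /\
   tail_equivalent (U k F) (H k F)) /\
  (* (c) *)
  (forall alpha : R, 0 < alpha -> in_Dl F (Phi alpha) ->
     [/\ right_end (U k F) = right_end F, right_end F = +oo%E,
         in_Dl (U k F) (Phi (k%:R * alpha)) &
         norming (U k F) (Phi (k%:R * alpha))
           (fun n => qinv F (level k n)) (fun=> 0)]) /\
  (* (d) *)
  (forall alpha : R, 0 < alpha -> in_Dl F (Psi alpha) ->
     [/\ right_end (U k F) = right_end F, (right_end F < +oo)%E,
         in_Dl (U k F) (Psi (k%:R * alpha)) &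
         norming (U k F) (Psi (k%:R * alpha))
           (fun n => fine (right_end F) - qinv F (level k n))
           (fun=> fine (right_end F))]) /\
  (* (e) *)
  (forall v : R -> R,
     in_Dl F Lambda ->
     (forall t, (t%:E < right_end F)%E -> 0 < v t) ->
     (forall x, 0 <= x ->
        (1 - F (t + v t * x)) / (1 - F t) @[t --> below (right_end F)]
          --> expR (- x)) ->
     [/\ norming F Lambda
           (fun n => v (qinv F (1 - n%:R^-1))) (fun n => qinv F (1 - n%:R^-1)),
         right_end (U k F) = right_end F,
         in_Dl (U k F) Lambda &
         norming (U k F) Lambda
           (fun n => v (qinv (U k F) (1 - n%:R^-1)) / k%:R)
           (fun n => qinv (U k F) (1 - n%:R^-1))]).
Proof.
have F_cont := pdf_df_continuous F_pdf.
have rU := right_end_U k_gt0 F_df.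
split; [|split; [|split; [|split]]].
- by split; [exact: is_df_U F_pdf|exact: rU|exact: has_pdf_U].
- split; first exact: cvg_U_ratio.
  exact: tail_equivalent_U_H F_pdf.
- move=> alpha al0 FPhi; have nU := norming_U_Phi k_gt0 F_df F_pdf al0 FPhi.
  split; [exact: rU| | |exact: nU].
    exact: (in_Dl_Phi_right_end F_df F_cont al0 FPhi).
  exact: (norming_in_Dl nU).
- move=> alpha al0 FPsi; have nU := norming_U_Psi k_gt0 F_df F_pdf al0 FPsi.
  split; [exact: rU| | |exact: nU].
    exact: (in_Dl_Psi_right_end k_gt0 F_df F_pdf al0 FPsi).
  exact: (norming_in_Dl nU).
- move=> v FL v0 Fv; have nU := norming_U_Lambda k_gt0 F_df F_pdf FL v0 Fv.
  split; [|exact: rU| |exact: nU].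
    exact: (norming_F_Lambda F_df F_pdf FL v0 Fv).
  exact: (norming_in_Dl nU).
Qed.
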